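(* Let $m\ge 2$ and $n\ge 2$ be integers, let $\Omega\subset\mathbb{R}^n$ be a domain, let $x_0\in\Omega$, and let $u$ be a solution of the polyharmonic equation $\Delta^m u=0$ in $\Omega\setminus\{x_0\}$. Then $u$ has a removable singularity at $x_0$ if and only if $$ |\Delta^k u(x)|=\begin{cases} o(|x-x_0|^{2-n}) \quad \forall k=0,1,2,\dots,m-1 \text{ as } |x-x_0|\to 0, & \text{if } n\ge 3,\\ o\bigl(\log(1/|x-x_0|)\bigr)\quad \forall k=0,1,2,\dots,m-1 \text{ as } |x-x_0|\to 0, & \text{if } n=2.\end{cases} $$
   Context: $\Delta$ is the Laplacian on $\mathbb{R}^n$, $\Delta^k$ is its $k$-fold iterate, and $\Delta^0u=u$. A domain is a nonempty connected open set. A solution of $\Delta^m u=0$ in an open set is a real-valued classical solution, i.e. a $C^{2m}$ function satisfying the equation pointwise there. Write $B_\delta(x_0)=\{x\in\mathbb{R}^n:|x-x_0|<\delta\}$. A solution $u$ of $\Delta^m u=0$ in $\Omega\setminus\{x_0\}$ is said to have a removable singularity at $x_0$ if there exist a constant $\delta>0$ with $\overline{B_\delta(x_0)}\subset\Omega$ and a smooth ($C^\infty$) solution $v$ of $\Delta^m v=0$ in $B_\delta(x_0)$ such that $u(x)=v(x)$ for all $0<|x-x_0|<\delta$. *)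

(* Defs.v *)
From mathcomp Require Import all_boot all_order all_algebra.
From mathcomp Require Import all_classical all_reals all_analysis.
Import Order.TTheory GRing.Theory Num.Theory.
Import numFieldNormedType.Exports.

Set Implicit Arguments.
Unset Strict Implicit.
Unset Printing Implicit Defensive.

Local Open Scope classical_set_scope.
Local Open Scope ring_scope.

(* The library norm on ['rV[R]_n] is the sup norm, so the Euclidean norm is
   defined here. Both induce the library topology of ['rV[R]_n], so open,
   closure, connected and the filter [x0^'] have their usual meaning. *)
Definition enorm (R : realType) (n : nat) (x : 'rV[R]_n) : R :=
  Num.sqrt (\sum_(i < n) x 0 i ^+ 2).

Definition eball (R : realType) (n : nat) (x0 : 'rV[R]_n) (r : R)
  : set 'rV[R]_n := [set x | enorm (x - x0) < r].

Definition domain (R : realType) (n : nat) (A : set 'rV[R]_n) : Prop :=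
  [/\ A !=set0, open A & connected A].

(* Functions on an open set [A] are represented by total functions, whose
   values outside [A] are irrelevant: derivatives at a point of [A] only depend
   on the values near that point. *)
Definition partial (R : realType) (n : nat) (i : 'I_n) (u : 'rV[R]_n -> R)
  : 'rV[R]_n -> R := fun x => 'D_('e_i) u x.

Definition laplacian (R : realType) (n : nat) (u : 'rV[R]_n -> R)
  : 'rV[R]_n -> R := fun x => \sum_(i < n) partial i (partial i u) x.

Definition iter_laplacian (R : realType) (n k : nat) (u : 'rV[R]_n -> R)
  : 'rV[R]_n -> R := iter k (@laplacian R n) u.

(* For [A] open: all partial derivatives of [u] of order at most [k] exist and
   are continuous on [A]. Existence must be required explicitly since ['D_v]
   is total. *)
Fixpoint class_C (R : realType) (n k : nat) (A : set 'rV[R]_n)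
    (u : 'rV[R]_n -> R) : Prop :=
  (forall x, A x -> {for x, continuous u}) /\
  if k is k'.+1 then
    forall i : 'I_n, (forall x, A x -> derivable u x 'e_i) /\
                     class_C k' A (partial i u)
  else True.

Definition smooth (R : realType) (n : nat) (A : set 'rV[R]_n)
    (u : 'rV[R]_n -> R) : Prop := forall k, class_C k A u.

Definition polyharmonic (R : realType) (n m : nat) (A : set 'rV[R]_n)
    (u : 'rV[R]_n -> R) : Prop :=
  class_C (2 * m) A u /\ forall x, A x -> iter_laplacian m u x = 0.

Definition removable_singularity (R : realType) (n m : nat)
    (Omega : set 'rV[R]_n) (x0 : 'rV[R]_n) (u : 'rV[R]_n -> R) : Prop :=
  exists delta : R,
    [/\ 0 < delta, closure (eball x0 delta) `<=` Omega &
      exists v : 'rV[R]_n -> R,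
        [/\ smooth (eball x0 delta) v,
            polyharmonic m (eball x0 delta) v &
            forall x, 0 < enorm (x - x0) < delta -> u x = v x]].

(* Main.v *)
(** A harmonic function [w] on a punctured ball with [w = o(Phi)], [Phi] the
    fundamental solution, is a uniform limit of harmonic polynomials, and no
    integration is needed to see it. By Stone-Weierstrass [w] is approximated on
    a sphere by polynomials; each polynomial agrees on the sphere with a harmonic
    one; and the maximum principle applied to [+-(w - h) - t Phi], [t -> 0], gives
    [|w - h| <= e] on the whole punctured ball as soon as it holds on the sphere.
    Bernstein's trick (the maximum principle for
    [(r^2 - |x|^2)^2 (d_i h)^2 + c h^2]) bounds the derivatives of [h] inside the
    ball by its sup norm, so that the limit is smooth and harmonic.

    For [Delta^(m+1) u = 0], let [h_k -> Delta^m u] be such harmonic polynomials.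
    Following Almansi, [h_k = Delta^m (|x|^(2m) G_k)] for harmonic polynomials
    [G_k] obtained by inverting operators [a + E], [E = x . grad], [a > 0]. At a
    maximum point of [q] over the ball [E q >= 0], hence
    [sup |q| <= sup |(a + E) q| / a], and the [G_k] converge too. Subtracting the
    limit of [|x|^(2m) G_k] from [u] lowers the order by one. *)

Require Import Defs.
From mathcomp Require Import all_boot all_order all_algebra.
From mathcomp Require Import all_classical all_reals all_analysis.
From mathcomp Require Import ring lra zify.
From mathcomp Require Import -(notations) mpoly.
Import Order.TTheory GRing.Theory Num.Theory.
Import numFieldNormedType.Exports.
Set Implicit Arguments.
Unset Strict Implicit.
Unset Printing Implicit Defensive.
Local Open Scope classical_set_scope.
Local Open Scope ring_scope.

(** * The Laplacian and the Euler operator on polynomials *)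

Section PolynomialLaplacian.
Variables (R : realFieldType) (n : nat).
Local Notation pol := (mpoly n R).
Implicit Types (p q g h : pol) (c : R) (i : 'I_n).

Definition pvar i : pol := mpolyX R (mnm1 i).
Definition plap p : pol := \sum_i mderiv i (mderiv i p).
Definition peuler p : pol := \sum_i pvar i * mderiv i p.
Definition psqn : pol := \sum_i pvar i ^+ 2.

Lemma mderiv_sum i (I : Type) (r : seq I) (P : pred I) (F : I -> pol) :
  mderiv i (\sum_(j <- r | P j) F j) = \sum_(j <- r | P j) mderiv i (F j).
Proof. exact: raddf_sum. Qed.

Lemma mderiv_pvar i j : mderiv i (pvar j) = (j == i)%:R.
Proof.
rewrite /pvar mderivX mnm1E; case: eqP => [->|_]; last by rewrite scale0r.
by rewrite scale1r -{1}[mnm1 i]add0m addmK mpolyX0.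
Qed.

Lemma plapD p q : plap (p + q) = plap p + plap q.
Proof. by rewrite /plap -big_split; apply: eq_bigr => i _; rewrite !mderivD. Qed.

Lemma plapZ c p : plap (c *: p) = c *: plap p.
Proof. by rewrite /plap scaler_sumr; apply: eq_bigr => i _; rewrite !mderivZ. Qed.

Lemma plap0 : plap 0 = 0.
Proof. by have := plapZ 0 0; rewrite !scale0r. Qed.

Lemma plapB p q : plap (p - q) = plap p - plap q.
Proof. by rewrite plapD -scaleN1r plapZ scaleN1r. Qed.

Lemma mderiv_plap i p : mderiv i (plap p) = plap (mderiv i p).
Proof.
rewrite mderiv_sum; apply: eq_bigr => j _.
by rewrite (mderiv_comm j i) (mderiv_comm j i).
Qed.

Lemma plapM p q :
  plap (p * q) = plap p * q + 2 *: (\sum_i mderiv i p * mderiv i q) + p * plap q.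
Proof.
rewrite /plap mulr_suml mulr_sumr scaler_sumr -!big_split; apply: eq_bigr => i _ /=.
by rewrite mderivM mderivD !mderivM scaler_nat; ring.
Qed.

(** * The Euler operator [E] and its commutation rules *)

Lemma peulerD p q : peuler (p + q) = peuler p + peuler q.
Proof. by rewrite /peuler -big_split; apply: eq_bigr => i _; rewrite mderivD mulrDr. Qed.

Lemma peulerZ c p : peuler (c *: p) = c *: peuler p.
Proof. by rewrite /peuler scaler_sumr; apply: eq_bigr => i _; rewrite mderivZ scalerAr. Qed.

Lemma peuler0 : peuler 0 = 0.
Proof. by have := peulerZ 0 0; rewrite !scale0r. Qed.

Lemma peulerB p q : peuler (p - q) = peuler p - peuler q.
Proof. by rewrite peulerD -scaleN1r peulerZ scaleN1r. Qed.

Lemma peulerM p q : peuler (p * q) = peuler p * q + p * peuler q.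
Proof.
rewrite /peuler mulr_suml mulr_sumr -big_split; apply: eq_bigr => i _ /=.
by rewrite mderivM; ring.
Qed.

Lemma mderiv_peuler i p : mderiv i (peuler p) = mderiv i p + peuler (mderiv i p).
Proof.
rewrite /peuler mderiv_sum.
under eq_bigr do rewrite mderivM mderiv_pvar (mderiv_comm _ i).
rewrite big_split/=; congr (_ + _).
rewrite (bigD1 i)//= eqxx mul1r big1 ?addr0// => j /negbTE ->.
by rewrite mul0r.
Qed.

(** The commutator of the Laplacian with [E] is twice the Laplacian: each of the two derivatives
    moved past [E] contributes one copy, by [mderiv_peuler]. *)
Lemma plap_peuler p : plap (peuler p) = peuler (plap p) + 2 *: plap p.
Proof.
have -> : peuler (plap p) = \sum_i peuler (mderiv i (mderiv i p)).
  rewrite exchange_big/=; apply: eq_bigr => i _.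
  by rewrite /plap mderiv_sum mulr_sumr.
rewrite /plap scaler_sumr -big_split; apply: eq_bigr => i _ /=.
by rewrite mderiv_peuler mderivD mderiv_peuler scaler_nat; ring.
Qed.

(** * Monomials as eigenvectors of [E], and the inversion of [a + E] *)

Lemma peuler_mono (m : multinom n) : peuler (mpolyX R m) = (mdeg m)%:R *: mpolyX R m.
Proof.
rewrite /peuler mdegE natr_sum scaler_suml; apply: eq_bigr => i _.
rewrite mderivX -scalerAr -mpolyXD.
(* Subtraction of exponents is truncated, so an absent variable is treated apart; its coefficient
   [m i] is zero. *)
have [->|mi] := eqVneq (m i) 0%N; first by rewrite !scale0r.
by rewrite addmC submK// lep1mP.
Qed.

Lemma peuler_sum (I : Type) (r : seq I) (P : pred I) (F : I -> pol) :
  peuler (\sum_(j <- r | P j) F j) = \sum_(j <- r | P j) peuler (F j).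
Proof.
exact: (big_morph _ peulerD peuler0).
Qed.

Lemma mcoeff_peuler p (m : multinom n) : mcoeff m (peuler p) = (mdeg m)%:R * mcoeff m p.
Proof.
rewrite [in LHS](mpolyE p) peuler_sum [in RHS](mpolyE p) !(raddf_sum (mcoeff m)) mulr_sumr.
apply: eq_bigr => k _ /=.
rewrite peulerZ peuler_mono !mcoeffZ mcoeffX.
case: eqP => [->|_]; first by ring.
by rewrite !mulr0.
Qed.

(** On the coefficient of a monomial of degree [d], the operator [a + E] acts as multiplication by
    [a + d > 0]. *)
Lemma peuler_shift_inj (a : R) p : 0 < a -> a *: p + peuler p = 0 -> p = 0.
Proof.
move=> a0 ap; apply/mpolyP => m; rewrite mcoeff0.
have : mcoeff m (a *: p + peuler p) = 0 by rewrite ap mcoeff0.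
rewrite mcoeffD mcoeffZ mcoeff_peuler -mulrDl => /eqP.
by rewrite mulf_eq0 gt_eqF ?orFb; [move/eqP | rewrite ltr_wpDr].
Qed.

Lemma peuler_shift_surj (a : R) p : 0 < a -> exists q, a *: q + peuler q = p.
Proof.
move=> a0; exists (\sum_(m <- msupp p) (mcoeff m p / (a + (mdeg m)%:R)) *: mpolyX R m).
rewrite peuler_sum scaler_sumr -big_split [RHS](mpolyE p); apply: eq_bigr => m _ /=.
rewrite peulerZ peuler_mono !scalerA -scalerDl; congr (_ *: _).
have : a + (mdeg m)%:R != 0 by rewrite gt_eqF// ltr_wpDr.
by move=> ?; field.
Qed.

(** By the commutation rule, [(a + 2) + E] kills [plap q], and it is injective. *)
Lemma plap_peuler_shift_inv (a : R) q h :
  0 < a -> a *: q + peuler q = h -> plap h = 0 -> plap q = 0.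
Proof.
move=> a0 <-; rewrite plapD plapZ plap_peuler => E.
apply: (@peuler_shift_inj (a + 2)); first by rewrite addr_gt0.
by rewrite -[RHS]E [in LHS]scalerDl; ring.
Qed.

(** * Products with powers of [|x|^2] *)

Lemma mderiv_psqn i : mderiv i psqn = 2 *: pvar i.
Proof.
rewrite mderiv_sum (bigD1 i)//= big1 ?addr0 => [|j ji].
  by rewrite expr2 mderivM mderiv_pvar eqxx scaler_nat mul1r mulr1 mulr2n.
by rewrite expr2 mderivM mderiv_pvar (negbTE ji) mul0r mulr0 addr0.
Qed.

Lemma peuler_psqn : peuler psqn = 2 *: psqn.
Proof.
rewrite scaler_sumr; apply: eq_bigr => i _.
by rewrite mderiv_psqn -scalerAr.
Qed.

Lemma peuler_psqnX j : peuler (psqn ^+ j) = (2 * j)%:R *: psqn ^+ j.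
Proof.
elim: j => [|j IH].
  rewrite muln0 scale0r expr0 /peuler big1// => i _.
  by rewrite -mpolyC1 mderivC mulr0.
by rewrite exprS peulerM IH peuler_psqn -scalerAl -scalerAr -scalerDl -natrD -mulnS.
Qed.

Lemma mderiv_psqnX i j : mderiv i (psqn ^+ j.+1) = (2 * j.+1)%:R *: (pvar i * psqn ^+ j).
Proof.
elim: j => [|j IH]; first by rewrite expr1 expr0 mderiv_psqn mulr1.
rewrite exprS mderivM IH mderiv_psqn -scalerAl -scalerAr mulrCA -exprS.
by rewrite -scalerDl -natrD -mulnS.
Qed.

(** For harmonic [g] the last term vanishes, and what remains is, up to a constant, [|x|^(2j)] times
    a shifted Euler operator applied to [g]: this is the step behind Almansi's construction. The
    term [peuler g] comes from the cross term of the Leibniz rule. *)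
Lemma plap_psqnM j g :
  plap (psqn ^+ j.+1 * g) =
  (2 * j.+1)%:R *: (psqn ^+ j * ((n + 2 * j)%:R *: g + 2 *: peuler g))
  + psqn ^+ j.+1 * plap g.
Proof.
rewrite plapM; congr (_ + _).
have -> : plap (psqn ^+ j.+1) = (2 * j.+1)%:R *: ((n + 2 * j)%:R *: psqn ^+ j).
  rewrite /plap; under eq_bigr do rewrite mderiv_psqnX mderivZ mderivM mderiv_pvar eqxx mul1r.
  rewrite -scaler_sumr; congr (_ *: _); rewrite big_split/= -/(peuler _) peuler_psqnX.
  by rewrite sumr_const card_ord natrD -scaler_nat -scalerDl.
have -> : \sum_i mderiv i (psqn ^+ j.+1) * mderiv i g =
    (2 * j.+1)%:R *: (psqn ^+ j * peuler g).
  rewrite /peuler mulr_sumr scaler_sumr; apply: eq_bigr => i _.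
  by rewrite mderiv_psqnX -!mul_mpolyC; ring.
by rewrite -!mul_mpolyC; ring.
Qed.

(** The equation [peuler g = d%:R *: g] stands for homogeneity of degree [d]. The commutation rule
    gives [plap g] the eigenvalue [d - 2]; when this is negative, injectivity of [(2 - d) + E]
    forces [plap g = 0], which also covers the truncated subtraction. *)
Lemma plap_eigen d g : peuler g = d%:R *: g -> 
  peuler (plap g) = (d - 2)%:R *: plap g /\ ((d < 2)%N -> plap g = 0).
Proof.
move=> E; have := plap_peuler g; rewrite E plapZ => F.
have G : (2 - d%:R) *: plap g + peuler (plap g) = 0.
  by rewrite scalerBl F; ring.
have Z : (d < 2)%N -> plap g = 0.
  by move=> d2; apply: peuler_shift_inj G; rewrite subr_gt0 ltr_nat.
split=> //; have [d2|/Z ->] := leqP 2 d; last first.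
  by rewrite scaler0 peuler0.
rewrite natrB// scalerBl.
by apply/eqP; rewrite -subr_eq0 -G scalerBl; apply/eqP; ring.
Qed.

(* By [plap_psqnM], solving for [psqn ^+ e * g] reduces to solving for
   [psqn ^+ e.+1 * plap g]. *)
Lemma plap_psqn_solve J e d g : (0 < n)%N ->
  peuler g = d%:R *: g -> iter J plap g = 0 ->
  exists q, peuler q = (d + 2 * e)%:R *: q /\ plap (psqn * q) = psqn ^+ e * g.
Proof.
move=> n0; elim: J e d g => [|J IH] e d g Eg.
  by move=> /= ->; exists 0; rewrite !mulr0 plap0 scaler0 peuler0.
rewrite iterSr => Jg; have [Elg dlt] := plap_eigen Eg.
have [q' [Eq' lq']] : exists q', peuler q' = (d + 2 * e)%:R *: q' /\
    plap (psqn * q') = psqn ^+ e.+1 * plap g.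
  have [d2|/dlt ->] := leqP 2 d; last first.
    by exists 0; rewrite !mulr0 plap0 scaler0 peuler0.
  have [q' [Eq' lq']] := IH e.+1 _ _ Elg Jg; exists q'; split=> //.
  by rewrite Eq'; congr (_%:R *: _); rewrite mulnS addnA subnK.
(* [c] is the factor with which [plap_psqnM] returns [psqn ^+ e * g] when [g] has degree [d];
   subtracting [q'] cancels the remaining term. *)
pose c : R := (2 * e.+1)%:R * ((n + 2 * e)%:R + 2 * d%:R).
have c0 : c != 0.
  by rewrite /c -natrM -natrD -natrM pnatr_eq0 -lt0n !muln_gt0 !addn_gt0 n0.
exists (c^-1 *: (psqn ^+ e * g - q')); split.
  rewrite peulerZ peulerB peulerM peuler_psqnX Eq' Eg -scalerAl -scalerAr -scalerDl.
  by rewrite -natrD addnC -scalerBr !scalerA mulrC.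
rewrite -scalerAr plapZ mulrBr plapB lq' mulrA -exprS plap_psqnM Eg addrK.
rewrite (scalerA 2) -[_ *: g + _]scalerDl -scalerAr (scalerA (2 * e.+1)%:R) -/c.
by rewrite scalerA mulVf ?scale1r.
Qed.

Lemma iter_plap_eigen J d g : peuler g = d%:R *: g -> (d < 2 * J)%N -> iter J plap g = 0.
Proof.
elim: J d g => [|J IH] d g Eg; first by rewrite muln0.
rewrite mulnS => dJ; rewrite iterSr; have [Elg lt2] := plap_eigen Eg.
case: (ltnP d 2) => [/lt2 ->|d2].
  by elim: (J) => //= k ->; rewrite plap0.
by apply: IH Elg _; rewrite ltn_subLR.
Qed.

(** The harmonic [h] agrees with [p] on the sphere [|x|^2 = c]. For homogeneous [g], some [q] of
    degree two less makes [g - |x|^2 q] harmonic; on the sphere [|x|^2 q] is [c q], and induction on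
    the degree treats [q]. Monomials give the general case by linearity. *)
Lemma harmonic_mod_sphere (c : R) p : (0 < n)%N ->
  exists h k, plap h = 0 /\ p = h + (psqn - c *: 1) * k.
Proof.
move=> n0.
have eig d g : peuler g = d%:R *: g ->
    exists h k, plap h = 0 /\ g = h + (psqn - c *: 1) * k.
  elim/ltn_ind: d g => d IH g Eg.
  have [Elg lt2] := plap_eigen Eg.
  have [d2|d2] := ltnP d 2.
    by exists g, 0; rewrite lt2// mulr0 addr0.
  have [q [Eq lq]] : exists q, peuler q = (d - 2)%:R *: q /\ plap (psqn * q) = plap g.
    (* [d] Laplacians annihilate [plap g], of degree [d - 2 < 2 * d]. *)
    have [|q [Eq lq]] := @plap_psqn_solve d 0 _ _ n0 Elg.
      by apply: iter_plap_eigen Elg _; rewrite mul2n -addnn; lia.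
    by exists q; rewrite Eq lq muln0 addn0 mul1r.
  have [|h1 [k1 [h10 qE]]] := IH (d - 2)%N _ q Eq; first by lia.
  exists (g - psqn * q + c *: h1), (q + c *: k1); split.
    by rewrite plapD plapZ h10 plapB lq subrr scaler0 addr0.
  have -> : c *: h1 = c *: (q - (psqn - c *: 1) * k1) by rewrite {1}qE addrK.
  by rewrite -!mul_mpolyC; ring.
rewrite (mpolyE p); elim: (msupp p) => [|m s [h [k [h0 IH]]]].
  by exists 0, 0; rewrite big_nil plap0 mulr0 addr0.
have [h1 [k1 [h10 E1]]] := eig _ _ (peuler_mono m).
exists (mcoeff m p *: h1 + h), (mcoeff m p *: k1 + k); split.
  by rewrite plapD plapZ h10 h0 scaler0 addr0.
by rewrite big_cons IH [in LHS]E1 -!mul_mpolyC; ring.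
Qed.

End PolynomialLaplacian.

(** * Directional derivatives, polynomial functions and the Euclidean norm *)

Section DirectionalDerivatives.
Variables (R : realType) (n : nat).
Implicit Types (x v : 'rV[R]_n) (f : 'rV[R]_n -> R).

(** Reduces directional derivatives to one real variable, where the chain rule and the mean value
    theorem apply. *)
Lemma is_derive_line f x v (t df : R) :
  is_derive (x + t *: v) v f df <-> is_derive t (1 : R) (fun s => f (x + s *: v)) df.
Proof.
have E : (fun h => h^-1 *: ((f \o shift (x + t *: v)) (h *: v) - f (x + t *: v))) =
    (fun h : R => h^-1 *: (((fun s => f (x + s *: v)) \o shift t) (h *: (1 : R))
                     - (fun s => f (x + s *: v)) t)).
  apply/funext => h /=; congr (_ *: (f _ - _)).
  by rewrite scalerDl [h *: 1]mulr1 addrCA.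
have dE : derivable f (x + t *: v) v = derivable (fun s : R => f (x + s *: v)) t 1.
  by rewrite /derivable E.
have vE : 'D_v f (x + t *: v) = 'D_1 (fun s : R => f (x + s *: v)) t.
  by rewrite /derive E.
split=> -[dv vv].
  by apply: DeriveDef; [rewrite -dE | rewrite -vE].
by apply: DeriveDef; [rewrite dE | rewrite vE].
Qed.

Lemma is_derive_line0 f x v (df : R) :
  is_derive x v f df <-> is_derive (0 : R) (1 : R) (fun s => f (x + s *: v)) df.
Proof. by rewrite -is_derive_line scale0r addr0. Qed.

Lemma is_derive_chain f (g : R -> R) x v (a b : R) :
  is_derive x v f a -> is_derive (f x) 1 g b -> is_derive x v (g \o f) (b * a).
Proof.
move=> /is_derive_line0 fa gb; apply/is_derive_line0.
apply: (@is_derive1_comp _ g (fun s => f (x + s *: v))) fa.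
by rewrite scale0r addr0.
Qed.

Lemma is_derive_coord x v (i : 'I_n) c : is_derive x v (fun y : 'rV[R]_n => y 0 i - c) (v 0 i).
Proof.
apply/is_derive_line0.
have -> : (fun s : R => (x + s *: v) 0 i - c) = cst (x 0 i - c) + v 0 i *: (id : R -> R).
  by apply/funext => s /=; rewrite !mxE -[RHS]/(x 0 i - c + v 0 i * s); ring.
have [d1 d2] := is_deriveD (is_derive_cst (x 0 i - c) (0 : R) 1)
  (is_deriveZ (v 0 i) (is_derive_id (0 : R) (1 : R))).
apply: DeriveDef; first exact: d1.
by rewrite [LHS]d2 add0r [LHS]mulr1.
Qed.

Lemma open_line (A : set 'rV[R]_n) x v : open A -> A x ->
  exists2 e : R, 0 < e & forall t : R, `|t| < e -> A (x + t *: v).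
Proof.
move=> oA Ax.
have : (fun t : R => x + t *: v) @ (0 : R) --> x + (0 : R) *: v.
  apply: cvgD; [exact: cvg_cst | apply: cvgZr_tmp; exact: cvg_id].
rewrite scale0r addr0 => /(_ A)/(_ (open_nbhs_nbhs (conj oA Ax))).
move=> /nbhs_ballP[e /= e0 eA]; exists e => // t te; apply: eA.
by rewrite /ball/= sub0r normrN.
Qed.

End DirectionalDerivatives.

Section PolynomialFunctions.
Variables (R : realType) (n : nat) (x0 : 'rV[R]_n).
Local Notation pol := (mpoly n R).
Implicit Types (x v : 'rV[R]_n) (p q : pol) (i : 'I_n).

Lemma mpoly_closure (P : pol -> Prop) :
  (forall c, P (mpolyC n c)) -> (forall i, P (pvar R i)) ->
  (forall p q, P p -> P q -> P (p + q)) -> (forall p q, P p -> P q -> P (p * q)) ->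
  forall p, P p.
Proof.
move=> PC PX PD PM; elim/mpolyind => [|c m p _ _ Pp]; first exact: PC.
apply: (PD) => //; rewrite -mul_mpolyC; apply: (PM); first exact: PC.
rewrite mpolyXE_id; elim/big_ind: _ => [|p1 p2|i _]; [exact: PC|exact: PM|].
elim: (m i) => [|k IH]; first by rewrite expr0; exact: PC.
by rewrite exprS; apply: PM => //; exact: PX.
Qed.

(** The variables stand for the coordinates of [x - x0], so that [psqn] becomes the squared distance
    to [x0] and polynomials are centred at the singularity. *)
Definition pev p x : R := meval (fun i => x 0 i - x0 0 i) p.

Lemma pevD p q x : pev (p + q) x = pev p x + pev q x.
Proof. exact: mevalD. Qed.

Lemma pevB p q x : pev (p - q) x = pev p x - pev q x.
Proof. exact: mevalB. Qed.

Lemma pevN p x : pev (- p) x = - pev p x.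
Proof. exact: mevalN. Qed.

Lemma pevM p q x : pev (p * q) x = pev p x * pev q x.
Proof. exact: mevalM. Qed.

Lemma pevZ c p x : pev (c *: p) x = c * pev p x.
Proof. exact: mevalZ. Qed.

Lemma pev0 x : pev 0 x = 0.
Proof. exact: meval0. Qed.

Lemma pev1 x : pev 1 x = 1.
Proof. exact: meval1. Qed.

Lemma pevX p k x : pev (p ^+ k) x = pev p x ^+ k.
Proof. exact: rmorphXn. Qed.

Lemma pev_var i x : pev (pvar R i) x = x 0 i - x0 0 i.
Proof. exact: mevalXU. Qed.

Lemma pev_sum (I : Type) (r : seq I) (P : pred I) (F : I -> pol) x :
  pev (\sum_(j <- r | P j) F j) x = \sum_(j <- r | P j) pev (F j) x.
Proof. exact: raddf_sum. Qed.

Lemma is_derive_pev p x v :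
  is_derive x v (pev p) (\sum_i v 0 i * pev (mderiv i p) x).
Proof.
elim/mpoly_closure: p => [c|i|p q dp dq|p q dp dq].
- have -> : pev (mpolyC n c) = cst c by apply/funext => y; exact: mevalC.
  apply: is_derive_eq; rewrite big1// => i _.
  by rewrite mderivC pev0 mulr0.
- have -> : pev (pvar R i) = (fun y => y 0 i - x0 0 i).
    by apply/funext => y; exact: pev_var.
  suff -> : \sum_j v 0 j * pev (mderiv j (pvar R i)) x = v 0 i by exact: is_derive_coord.
  rewrite (bigD1 i)//= mderiv_pvar eqxx pev1 mulr1 big1 ?addr0// => j ji.
  by rewrite mderiv_pvar eq_sym (negbTE ji) pev0 mulr0.
- have -> : pev (p + q) = pev p + pev q by apply/funext => y; exact: pevD.
  apply: is_derive_eq; rewrite -big_split; apply: eq_bigr => i _ /=.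
  by rewrite mderivD pevD mulrDr.
- have -> : pev (p * q) = pev p * pev q by apply/funext => y; exact: pevM.
  apply: is_derive_eq; rewrite /GRing.scale/= !mulr_sumr -big_split.
  by apply: eq_bigr => i _ /=; rewrite mderivM pevD !pevM; ring.
Qed.

Lemma pev_derivable p x i : derivable (pev p) x 'e_i.
Proof. by have [] := is_derive_pev p x 'e_i. Qed.

Lemma partial_pev i p : partial i (pev p) = pev (mderiv i p).
Proof.
apply/funext => x; rewrite /partial; have [_ ->] := is_derive_pev p x 'e_i.
rewrite (bigD1 i)//= big1 => [|j ji]; first by rewrite mxE !eqxx mul1r addr0.
by rewrite mxE (negbTE ji) mul0r.
Qed.

Lemma pev_continuous p : continuous (pev p).
Proof.
elim/mpoly_closure: p => [c|i|p q dp dq|p q dp dq] x.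
- have -> : pev (mpolyC n c) = cst c by apply/funext => y; exact: mevalC.
  exact: cst_continuous.
- have -> : pev (pvar R i) = (fun y : 'rV[R]_n => y 0 i) - cst (x0 0 i).
    by apply/funext => y; exact: pev_var.
  by apply: continuousB; [exact: coord_continuous | exact: cst_continuous].
- have -> : pev (p + q) = pev p + pev q by apply/funext => y; exact: pevD.
  exact: continuousD (dp x) (dq x).
- have -> : pev (p * q) = pev p * pev q by apply/funext => y; exact: pevM.
  exact: continuousM (dp x) (dq x).
Qed.

Lemma class_C_pev k (A : set 'rV[R]_n) p : class_C k A (pev p).
Proof.
elim: k p => [|k IH] p; split=> //; try by move=> x _; exact: pev_continuous.
move=> i; split=> [x _|]; first exact: pev_derivable.
by rewrite partial_pev.
Qed.

Lemma laplacian_pev p : laplacian (pev p) = pev (plap p).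
Proof.
apply/funext => x; rewrite /laplacian /plap pev_sum.
by apply: eq_bigr => i _; rewrite !partial_pev.
Qed.

Lemma iter_laplacian_pev k p : iter_laplacian k (pev p) = pev (iter k (@plap R n) p).
Proof.
elim: k => //= k IH.
by rewrite /iter_laplacian /= -/(iter_laplacian k _) IH laplacian_pev.
Qed.

(** * The Euclidean norm and its compatibility with the topology *)

Lemma enorm_ge0 x : 0 <= enorm x.
Proof. exact: sqrtr_ge0. Qed.

Lemma enorm_sqr x : enorm x ^+ 2 = \sum_i x 0 i ^+ 2.
Proof. by rewrite sqr_sqrtr// sumr_ge0// => i _; rewrite sqr_ge0. Qed.

Lemma pev_psqn x : pev (psqn R n) x = enorm (x - x0) ^+ 2.
Proof.
rewrite enorm_sqr pev_sum; apply: eq_bigr => i _.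
by rewrite pevX pev_var !mxE.
Qed.

Lemma enorm_sqrt_pev x : enorm (x - x0) = Num.sqrt (pev (psqn R n) x).
Proof. by rewrite pev_psqn sqrtr_sqr ger0_norm// enorm_ge0. Qed.

Lemma enorm_continuous : continuous (fun x => enorm (x - x0)).
Proof.
move=> x; have -> : (fun x => enorm (x - x0)) = Num.sqrt \o pev (psqn R n).
  by apply/funext => y /=; rewrite enorm_sqrt_pev.
apply: continuous_comp; [exact: pev_continuous | exact: sqrt_continuous].
Qed.

Lemma coord_le_enorm x i : `|x 0 i| <= enorm x.
Proof.
rewrite -(ler_pXn2r (n := 2))// ?nnegrE ?enorm_ge0//.
rewrite enorm_sqr real_normK ?num_real// (bigD1 i)//= lerDl.
by rewrite sumr_ge0// => j _; rewrite sqr_ge0.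
Qed.

Lemma norm_le_enorm x : `|x| <= enorm x.
Proof.
rewrite [leLHS]/Num.Def.normr/= mx_normrE (bigmax_le _ (enorm_ge0 x))// => -[i j] _ /=.
by rewrite (ord1 i) coord_le_enorm.
Qed.

Lemma enorm_eq0 x : enorm x = 0 -> x = 0.
Proof.
move=> E; apply/eqP; rewrite -normr_eq0 eq_le normr_ge0 andbT -E.
exact: norm_le_enorm.
Qed.

Lemma enorm0 : enorm (0 : 'rV[R]_n) = 0.
Proof. by rewrite /enorm big1 ?sqrtr0// => i _; rewrite mxE expr0n. Qed.

Lemma enorm_gt0 x : x != x0 -> 0 < enorm (x - x0).
Proof.
move=> xx; rewrite lt_neqAle enorm_ge0 andbT eq_sym; apply/eqP => /enorm_eq0 /eqP.
by rewrite subr_eq0 (negbTE xx).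
Qed.

Lemma enormZ (t : R) x : enorm (t *: x) = `|t| * enorm x.
Proof.
rewrite /enorm; under eq_bigr do rewrite mxE exprMn.
by rewrite -mulr_sumr sqrtrM ?sqr_ge0// sqrtr_sqr.
Qed.

Lemma open_enorm_lt r : open [set x | enorm (x - x0) < r].
Proof.
apply: (@open_comp _ _ (fun x => enorm (x - x0)) [set y | y < r]); last exact: open_lt.
by move=> x _; exact: enorm_continuous.
Qed.

Lemma open_enorm_gt r : open [set x | r < enorm (x - x0)].
Proof.
apply: (@open_comp _ _ (fun x => enorm (x - x0)) [set y | r < y]); last exact: open_gt.
by move=> x _; exact: enorm_continuous.
Qed.

Lemma closed_enorm_le r : closed [set x | enorm (x - x0) <= r].
Proof.
have /continuous_closedP H := @enorm_continuous.
exact: (H [set y | y <= r] (@closed_le R r)).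
Qed.

Lemma closed_enorm_ge r : closed [set x | r <= enorm (x - x0)].
Proof.
have /continuous_closedP H := @enorm_continuous.
exact: (H [set y | r <= y] (@closed_ge R r)).
Qed.

(** Boundedness refers to the sup norm, which the Euclidean norm dominates. *)
Lemma compact_enorm (A : set 'rV[R]_n) r : closed A ->
  (forall x, A x -> enorm (x - x0) <= r) -> compact A.
Proof.
move=> cA Ar; apply: bounded_closed_compact => //.
exists (r + `|x0|); split; first exact: num_real.
move=> M rM x Ax; rewrite -(subrK x0 x); apply: (le_trans (ler_normD _ _)).
apply/ltW/(le_lt_trans _ rM); rewrite lerD2r.
exact: le_trans (norm_le_enorm _) (Ar _ Ax).
Qed.

(** One direction uses that the sup norm is at most the Euclidean norm, the other that Euclidean
    balls are open. *)
Lemma dnbhs_enormP (P : set 'rV[R]_n) : (\forall x \near x0^', P x) <->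
  exists2 d, 0 < d & forall x, 0 < enorm (x - x0) < d -> P x.
Proof.
split.
  move=> /nbhs_ballP[e /= e0 eP]; exists e => // x /andP[x1 x2].
  apply: eP; last first.
    by apply/eqP => xx; move: x1; rewrite xx subrr enorm0 ltxx.
  rewrite mx_norm_ball /ball_/= -normrN opprB.
  exact: le_lt_trans (norm_le_enorm _) x2.
move=> [d d0 dP].
have : nbhs x0 [set x | enorm (x - x0) < d].
  by apply: open_nbhs_nbhs; split; [exact: open_enorm_lt|rewrite /= subrr enorm0].
move=> nd; rewrite /prop_near1 /dnbhs; apply: filterS nd => x xd xx.
by apply: dP; rewrite xd andbT; exact: enorm_gt0.
Qed.

End PolynomialFunctions.

(** * Functions of class C^k *)

Section ClassC.
Variables (R : realType) (n : nat).
Implicit Types (A B : set 'rV[R]_n) (u v : 'rV[R]_n -> R) (x : 'rV[R]_n) (i : 'I_n).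

Lemma class_C_continuous k A u x : class_C k A u -> A x -> {for x, continuous u}.
Proof. by case: k => [|k] [cu _] Ax; exact: cu. Qed.

Lemma class_CW k A u : class_C k.+1 A u -> class_C k A u.
Proof.
elim: k u => [|k IH] u [cu du]; split=> // i.
by have [di ci] := du i; split=> //; exact: IH.
Qed.

Lemma class_C_le j k A u : (j <= k)%N -> class_C k A u -> class_C j A u.
Proof.
move=> jk; rewrite -(subnK jk); elim: (k - j)%N => // d IH /class_CW; exact: IH.
Qed.

Lemma class_CS k A B u : A `<=` B -> class_C k B u -> class_C k A u.
Proof.
move=> AB; elim: k u => [|k IH] u [cu du]; split=> //; try by move=> x /AB /cu.
by move=> i; have [di ci] := du i; split; [move=> x /AB /di|exact: IH].
Qed.

Lemma near_open A u v x : open A -> {in A, u =1 v} -> A x -> {near x, u =1 v}.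
Proof.
move=> oA uv Ax; have : nbhs x A by apply: open_nbhs_nbhs.
by apply: filterS => y Ay; apply: uv; rewrite inE.
Qed.

Lemma partial_eq A u v i : open A -> {in A, u =1 v} -> {in A, partial i u =1 partial i v}.
Proof.
by move=> oA uv x; rewrite inE => Ax; apply: near_eq_derive; exact: near_open uv _.
Qed.

Lemma laplacian_eq A u v : open A -> {in A, u =1 v} -> {in A, laplacian u =1 laplacian v}.
Proof.
move=> oA uv x Ax; apply: eq_bigr => i _.
exact: (partial_eq i oA (partial_eq i oA uv)).
Qed.

Lemma iter_laplacian_eq k A u v : open A -> {in A, u =1 v} ->
  {in A, iter_laplacian k u =1 iter_laplacian k v}.
Proof. by move=> oA uv; elim: k => [|k IH]; [exact: uv|exact: (laplacian_eq oA IH)]. Qed.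

(** On an open set derivatives depend on nearby values only. This is how explicit formulas for
    partial derivatives, valid on [A] alone, are fed back into [class_C]. *)
Lemma class_C_eq k A u v : open A -> {in A, u =1 v} -> class_C k A u -> class_C k A v.
Proof.
move=> oA; have cont u' v' : {in A, u' =1 v'} ->
    (forall x, A x -> {for x, continuous u'}) -> forall x, A x -> {for x, continuous v'}.
  move=> uv' cu x Ax; rewrite /prop_for /continuous_at -uv' ?inE//.
  by apply: cvg_trans (cu _ Ax); exact: near_eq_cvg (near_open oA uv' Ax).
elim: k u v => [|k IH] u v uv [cu du]; first by split=> //; exact: cont cu.
split=> [|i]; first exact: cont cu.
have [di ci] := du i; split.
  by move=> x Ax; apply: near_eq_derivable (di _ Ax); exact: near_open uv _.
by apply: IH ci; exact: partial_eq.
Qed.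

Lemma partial_lin A u v i (c : R) : (forall x, A x -> derivable u x 'e_i) ->
  (forall x, A x -> derivable v x 'e_i) ->
  {in A, partial i (fun x => u x + c * v x) =1 fun x => partial i u x + c * partial i v x}.
Proof.
move=> du dv x; rewrite inE => Ax.
have Du := derivableP (du x Ax); have Dv := derivableP (dv x Ax).
by have [_ E] := is_deriveD Du (is_deriveZ c Dv); exact: E.
Qed.

Lemma class_C_lin k A u v (c : R) : open A -> class_C k A u -> class_C k A v ->
  class_C k A (fun x => u x + c * v x).
Proof.
move=> oA; have cont u' v' : (forall x, A x -> {for x, continuous u'}) ->
    (forall x, A x -> {for x, continuous v'}) ->
    forall x, A x -> {for x, continuous (fun x => u' x + c * v' x)}.
  move=> cu cv x Ax; apply: (continuousD (cu _ Ax)).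
  by apply: continuousM (cv _ Ax); exact: cst_continuous.
elim: k u v => [|k IH] u v [cu du] [cv dv]; first by split=> //; exact: cont.
split=> [|i]; first exact: cont.
have [di ci] := du i; have [di' ci'] := dv i; split.
  move=> x Ax; apply: derivableD; first exact: di.
  by apply: derivableZ; exact: di'.
apply: class_C_eq oA _ (IH _ _ ci ci') => x Ax.
by rewrite (partial_lin c di di').
Qed.

Lemma class_C_cst k A (c : R) : class_C k A (fun=> c).
Proof.
suff : class_C k A (pev (n := n) 0 (mpolyC n c)).
  by congr (class_C _ _ _); apply/funext => y; exact: mevalC.
exact: class_C_pev.
Qed.

Lemma class_C_sum k A (s : seq 'I_n) (F : 'I_n -> 'rV[R]_n -> R) : open A ->
  (forall i, class_C k A (F i)) -> class_C k A (fun x => \sum_(i <- s) F i x).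
Proof.
move=> oA cF; elim: s => [|i s IH].
  by apply: class_C_eq oA _ (class_C_cst _ _ 0) => x _; rewrite big_nil.
apply: class_C_eq oA _ (class_C_lin 1 oA (cF i) IH) => x _.
by rewrite big_cons mul1r.
Qed.

Lemma class_C_partial k A u i : class_C k.+1 A u -> class_C k A (partial i u).
Proof. by case=> _ /(_ i)[]. Qed.

Lemma class_C_laplacian k A u : open A -> class_C k.+2 A u -> class_C k A (laplacian u).
Proof.
by move=> oA cu; apply: class_C_sum => // i; do 2!apply: class_C_partial.
Qed.

Lemma class_C_iter_laplacian j k A u : open A -> class_C (2 * k + j) A u ->
  class_C j A (iter_laplacian k u).
Proof.
move=> oA; elim: k j => [|k IH] j // cu; apply: class_C_laplacian => //.
by apply: IH; rewrite !addnS; rewrite mulnS in cu.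
Qed.

Lemma laplacian_lin A u v (c : R) : open A -> class_C 2 A u -> class_C 2 A v ->
  {in A, laplacian (fun x => u x + c * v x) =1 fun x => laplacian u x + c * laplacian v x}.
Proof.
move=> oA cu cv x Ax; rewrite /laplacian mulr_sumr -big_split; apply: eq_bigr => i _ /=.
have [_ /(_ i)[du [_ /(_ i)[ddu _]]]] := cu; have [_ /(_ i)[dv [_ /(_ i)[ddv _]]]] := cv.
rewrite (partial_eq i oA (partial_lin c du dv))//.
by rewrite (partial_lin c ddu ddv).
Qed.

Lemma iter_laplacian_lin k A u v (c : R) : open A ->
  class_C (2 * k) A u -> class_C (2 * k) A v ->
  {in A, iter_laplacian k (fun x => u x + c * v x) =1
         fun x => iter_laplacian k u x + c * iter_laplacian k v x}.
Proof.
move=> oA; elim: k => [|k IH] // cu cv.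
rewrite mulnS addnC in cu cv.
have IH' := IH (class_C_le (leq_addr _ _) cu) (class_C_le (leq_addr _ _) cv).
move=> x Ax; rewrite /iter_laplacian/= (laplacian_eq oA IH' Ax).
by rewrite (laplacian_lin c oA)//; exact: class_C_iter_laplacian.
Qed.

End ClassC.

(** * The maximum principle *)

Section MaximumPrinciple.
Variable R : realType.

(** Here [g] is the derivative of [f], and [c] the second derivative at [0]. Fermat gives [g 0 = 0];
    were [c] positive, [g] would be positive just to the right of [0], and the mean value theorem
    would make [f] exceed [f 0] there. *)
Lemma second_derive_max (f g : R -> R) (c e : R) : 0 < e ->
  (forall t : R, `|t| < e -> is_derive t (1 : R) f (g t)) -> is_derive (0 : R) (1 : R) g c ->
  (forall t : R, `|t| < e -> f t <= f 0) -> c <= 0.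
Proof.
move=> e0 df dg fmax; rewrite leNgt; apply/negP => c0.
have g00 : g 0 = 0.
  have : is_derive (0 : R) (1 : R) f 0.
    apply: (@derive1_at_max _ f (- e) e 0); first by lra.
    - by move=> t; rewrite in_itv/= => te; apply: ex_derive; apply: df; rewrite ltr_norml.
    - by rewrite in_itv/= oppr_lt0 e0.
    - by move=> t; rewrite in_itv/= => te; apply: fmax; rewrite ltr_norml.
  by move=> [_ E0]; have [|_ <-] := df 0; rewrite ?normr0.
have [dg1 dg2] := dg.
have : (fun h : R => h^-1 *: ((g \o shift 0) (h *: (1 : R)) - g 0)) @ (0 : R)^' --> c.
  by rewrite -dg2; exact: dg1.
move=> /cvgr_gt /(_ 0 c0) /nbhs_ballP[d /= d0 dP].
have gpos t : 0 < t -> t < d -> 0 < g t.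
  move=> t0 td; have := dP t; rewrite /ball/= sub0r normrN gtr0_norm// => /(_ td).
  rewrite g00 subr0 addr0 [t *: 1]mulr1 => /(_ (lt0r_neq0 t0)).
  by move=> H; rewrite -(@pmulr_rgt0 _ t^-1) ?invr_gt0.
pose h := Num.min d e / 2.
have h0 : 0 < h by rewrite divr_gt0// lt_min d0.
have hm : h < Num.min d e by rewrite ltr_pdivrMr// ltr_pMr ?ltr1n// lt_min d0.
have /andP[hd he] : (h < d) && (h < e) by rewrite -lt_min.
have [||x] := @MVT R f g 0 h h0.
- move=> t; rewrite in_itv/= => /andP[t0 th]; apply: df.
  by rewrite gtr0_norm// (lt_trans th).
- apply: derivable_within_continuous => t; rewrite in_itv/= => /andP[t0 th].
  by apply: ex_derive; apply: df; rewrite ger0_norm// (le_lt_trans th).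
rewrite in_itv/= => /andP[x1 x2] E.
have : 0 < f h - f 0 by rewrite E subr0 mulr_gt0// gpos// (lt_trans x2).
by rewrite subr_gt0 ltNge fmax// gtr0_norm.
Qed.

Variable n : nat.
Implicit Types (K U : set 'rV[R]_n) (f : 'rV[R]_n -> R) (x : 'rV[R]_n).

Lemma laplacian_max_le0 U f x : open U -> U x -> class_C 2 U f ->
  (forall y, U y -> f y <= f x) -> laplacian f x <= 0.
Proof.
move=> oU Ux [_ cf] fmax; apply: sumr_le0 => i _.
have [df [_ /(_ i)[ddf _]]] := cf i.
have [e e0 eU] := open_line 'e_i oU Ux.
apply: (@second_derive_max (fun t => f (x + t *: 'e_i))
  (fun t => partial i f (x + t *: 'e_i)) _ e e0) => [t te||t te].
- by apply/is_derive_line/derivableP; exact/df/eU.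
- by apply/is_derive_line0/derivableP; exact/ddf.
- by rewrite scale0r addr0; exact/fmax/eU.
Qed.

Lemma plap_psqn : plap (psqn R n) = (2 * n)%:R *: 1.
Proof.
rewrite /plap; under eq_bigr do rewrite mderiv_psqn mderivZ mderiv_pvar eqxx.
by rewrite sumr_const card_ord -scaler_nat scalerA -natrM mulnC.
Qed.

(** The points of [K] outside [U] play the role of the boundary. Adding a small multiple of [|x|^2]
    makes the Laplacian strictly positive, so that the maximum over [K] cannot lie in [U]; the
    multiple then tends to zero. *)
Lemma maximum_principle K U f (M : R) : (0 < n)%N -> compact K -> open U -> U `<=` K ->
  (forall x, K x -> {for x, continuous f}) -> class_C 2 U f ->
  (forall x, U x -> 0 <= laplacian f x) -> (forall x, K x -> ~ U x -> f x <= M) ->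
  forall x, K x -> f x <= M.
Proof.
move=> n0 cK oU UK cf c2 lf fM x Kx.
pose N := pev 0 (psqn R n).
have K0 : K !=set0 by exists x.
have cw (g : 'rV[R]_n -> R) : (forall x, K x -> {for x, continuous g}) -> {within K, continuous g}.
  by move=> cg; apply: (@continuous_in_subspaceT _ _ K g) => y; rewrite inE; exact: cg.
have [b bK bmax] : exists2 b, K b & forall y, K y -> N y <= N b.
  have [|b bK bm] := @compact_EVT_max _ _ N K K0 cK.
    by apply: cw => y _; exact: pev_continuous.
  by exists b => [|y Ky]; [rewrite inE in bK|apply: bm; rewrite inE].
have N0 y : 0 <= N y by rewrite /N pev_psqn sqr_ge0.
apply/ler_addgt0Pr => e e0.
pose d := e / (N b + 1).
have b1 : 0 < N b + 1 by rewrite ltr_wpDl.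
have d0 : 0 < d by rewrite divr_gt0.
pose g y := f y + d * N y.
have [z zK zmax] : exists2 z, K z & forall y, K y -> g y <= g z.
  have [|z zK zm] := @compact_EVT_max _ _ g K K0 cK.
    apply: cw => y Ky; apply: (continuousD (cf _ Ky)).
    by apply: continuousM; [exact: cst_continuous|exact: pev_continuous].
  by exists z => [|y Ky]; [rewrite inE in zK|apply: zm; rewrite inE].
have [Uz|nUz] := pselect (U z).
  have cN : class_C 2 U N by exact: class_C_pev.
  have : laplacian g z <= 0.
    apply: (laplacian_max_le0 oU Uz) => [|y Uy]; first exact: class_C_lin.
    by apply: zmax; exact: UK.
  rewrite leNgt (laplacian_lin d oU c2 cN) ?inE// laplacian_pev plap_psqn pevZ pev1 mulr1.
  by rewrite ltr_wpDl ?lf// mulr_gt0// ltr0n muln_gt0.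
apply: (le_trans (_ : f x <= g x)); first by rewrite lerDl mulr_ge0// ltW.
apply: (le_trans (zmax _ Kx)); rewrite lerD ?fM// /d mulrAC ler_pdivrMr//.
by rewrite ler_pM2l// (le_trans (bmax _ zK))// lerDl.
Qed.

End MaximumPrinciple.

(** * Estimates for polynomials *)

Section HarmonicPolynomials.
Variables (R : realType) (n : nat) (x0 : 'rV[R]_n).
Hypothesis n_gt0 : (0 < n)%N.
Local Notation pol := (mpoly n R).
Local Notation pev := (pev x0).
Implicit Types (x v : 'rV[R]_n) (p q h : pol) (i : 'I_n) (r s M : R).

Lemma compact_enorm_le r : compact [set x | enorm (x - x0) <= r].
Proof. by apply: (@compact_enorm _ _ x0 _ r) => //; exact: closed_enorm_le. Qed.

Lemma pev_max_principle p r M :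
  (forall x, enorm (x - x0) < r -> 0 <= pev (plap p) x) ->
  (forall x, enorm (x - x0) = r -> pev p x <= M) ->
  forall x, enorm (x - x0) <= r -> pev p x <= M.
Proof.
move=> lp pM; have := @maximum_principle R n _ _ (pev p) M n_gt0 (@compact_enorm_le r)
  (@open_enorm_lt _ _ x0 r); apply.
- by move=> x /= /ltW.
- by move=> x _; exact: pev_continuous.
- exact: class_C_pev.
- by move=> x xr; rewrite laplacian_pev; exact: lp.
- move=> x /= xr nxr; apply: pM; apply/eqP; rewrite eq_le xr/= leNgt.
  exact/negP.
Qed.

Lemma harmonic_bound p r M : plap p = 0 ->
  (forall x, enorm (x - x0) = r -> `|pev p x| <= M) ->
  forall x, enorm (x - x0) <= r -> `|pev p x| <= M.
Proof.
move=> hp pM x xr; rewrite ler_norml; apply/andP; split.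
  rewrite lerNl -mulN1r -pevZ; apply: pev_max_principle x xr => x xr.
    by rewrite plapZ hp scaler0 pev0.
  by rewrite pevZ mulN1r (le_trans (ler_norm _))// normrN pM.
apply: pev_max_principle x xr => x xr; first by rewrite hp pev0.
by rewrite (le_trans (ler_norm _))// pM.
Qed.

Lemma plap_sqr p :
  plap (p ^+ 2) = 2 *: (p * plap p) + 2 *: (\sum_i mderiv i p ^+ 2).
Proof.
rewrite expr2 plapM !scaler_nat.
by under eq_bigr do rewrite -expr2; rewrite [plap p * p]mulrC; ring.
Qed.

Lemma mderiv_sqr i p : mderiv i (p ^+ 2) = 2 *: (p * mderiv i p).
Proof. by rewrite expr2 mderivM scaler_nat; ring. Qed.

(** The Laplacian of [eta^2 (d_i p)^2] has terms of the wrong sign, controlled by a multiple of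
    [r^2 (d_i p)^2]. For harmonic [p] the Laplacian of [p^2] is [2 |grad p|^2], and the factor
    [(2n + 16) r^2] makes it large enough to absorb them. *)
Lemma bernstein_subharmonic p i r x (eta := r ^+ 2 *: 1 - psqn R n : pol) :
  plap p = 0 -> enorm (x - x0) < r ->
  0 <= pev (plap (eta ^+ 2 * mderiv i p ^+ 2
            + ((2 * n + 16)%:R * r ^+ 2) *: p ^+ 2)) x.
Proof.
move=> hp xr; set g := mderiv i p; set c := _ * r ^+ 2.
have hg : plap g = 0 by rewrite -mderiv_plap hp mderiv0.
have deta j : mderiv j eta = - (2 *: pvar R j).
  by rewrite /eta mderivB mderivZ -mpolyC1 mderivC scaler0 sub0r mderiv_psqn.
have leta : plap eta = - ((2 * n)%:R *: 1).
  rewrite /eta plapB plapZ plap_psqn /plap big1 ?scaler0 ?sub0r// => j _.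
  by rewrite -mpolyC1 !mderivC ?mderiv0.
rewrite plapD plapZ plapM !plap_sqr hp hg leta.
have -> : \sum_j mderiv j (eta ^+ 2) * mderiv j (g ^+ 2) =
    - (8 *: \sum_j eta * pvar R j * g * mderiv j g).
  rewrite scaler_sumr -sumrN; apply: eq_bigr => j _.
  by rewrite !mderiv_sqr deta !scaler_nat; ring.
have -> : \sum_j mderiv j eta ^+ 2 = 4 *: psqn R n.
  rewrite scaler_sumr; apply: eq_bigr => j _.
  by rewrite deta !scaler_nat; ring.
rewrite !mulr0 !scaler0 !add0r.
set E := r ^+ 2 - pev (psqn R n) x.
have etaE : pev eta x = E by rewrite pevB pevZ pev1 mulr1.
have r2 : enorm (x - x0) ^+ 2 < r ^+ 2.
  by rewrite ltr_pXn2r// nnegrE ?enorm_ge0// (le_trans _ (ltW xr))// enorm_ge0.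
clearbody eta; pose X j := pev (pvar R j) x; pose g' j := pev (mderiv j g) x.
pose S1 := \sum_j X j * g' j; pose S2 := \sum_j g' j ^+ 2.
set N := pev (psqn R n) x; pose G := pev g x; pose T := \sum_j pev (mderiv j p) x ^+ 2.
have NE : N = \sum_j X j ^+ 2.
  by rewrite /N pev_sum; apply: eq_bigr => j _; rewrite pevX.
have N_le : N <= r ^+ 2 by rewrite /N pev_psqn ltW.
have N_ge0 : 0 <= N by rewrite /N pev_psqn sqr_ge0.
have T_ge : G ^+ 2 <= T.
  by rewrite /T (bigD1 i)//= lerDl sumr_ge0// => j _; rewrite sqr_ge0.
(* Completes the square in [eta^2 |grad g|^2 - 8 eta g (x . grad g)]. *)
have sq (a b : R) : 0 <= a ^+ 2 * S2 - 8 * a * b * S1 + 16 * N * b ^+ 2.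
  have -> : a ^+ 2 * S2 - 8 * a * b * S1 + 16 * N * b ^+ 2 =
      \sum_j (a * g' j - 4 * X j * b) ^+ 2.
    rewrite NE /S1 /S2 !(mulr_sumr, mulr_suml) -sumrB -big_split/=.
    by apply: eq_bigr => j _; ring.
  by rewrite sumr_ge0// => j _; rewrite sqr_ge0.
have A1 : pev (\sum_j eta * pvar R j * g * mderiv j g) x = E * G * S1.
  rewrite pev_sum /S1 mulr_sumr; apply: eq_bigr => j _.
  by rewrite !pevM etaE -/(X j) -/(g' j) -/G; ring.
have A2 : pev (\sum_j mderiv j g ^+ 2) x = S2.
  by rewrite pev_sum; apply: eq_bigr => j _; rewrite pevX.
have A3 : pev (\sum_j mderiv j p ^+ 2) x = T.
  by rewrite pev_sum; apply: eq_bigr => j _; rewrite pevX.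
rewrite !(pevD, pevZ, pevM, pevX, pevN, pev1) A1 A2 A3 etaE -/N -/G mulr1 -expr2.
have {sq} := sq E G; set K := _ - _ + _ => K0.
(* Once the square [K] is split off, the choice of [c] leaves [G ^+ 2] with a coefficient that is
   nonnegative because [0 <= N <= r ^+ 2]. *)
set L := (X in 0 <= X); have -> : L =
  2 * K + 2 * c * (T - G ^+ 2)
  + G ^+ 2 * ((4 * n)%:R * N + 32 * (r ^+ 2 - N) + 8 * N).
  by rewrite /L /K /c /E -/N; ring.
have c0 : 0 <= c by rewrite mulr_ge0// sqr_ge0.
apply: addr_ge0; first apply: addr_ge0.
- by apply: mulr_ge0.
- by apply: mulr_ge0; rewrite ?subr_ge0//; apply: mulr_ge0.
- apply: mulr_ge0; first exact: sqr_ge0.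
  by rewrite !addr_ge0// mulr_ge0// subr_ge0.
Qed.

(** Bernstein's function is at most [k r^2 M^2] on the sphere of radius [r], where [eta] vanishes,
    hence also inside; on the ball of radius [s], [eta] is at least [r^2 - s^2]. The bound is linear
    in [M], as Cauchy sequences require. *)
Lemma mderiv_bound p i r s M : 0 <= s -> s < r -> plap p = 0 ->
  (forall x, enorm (x - x0) <= r -> `|pev p x| <= M) ->
  forall x, enorm (x - x0) <= s ->
    `|pev (mderiv i p) x| <= (2 * n + 16)%:R * r / (r ^+ 2 - s ^+ 2) * M.
Proof.
move=> s0 sr hp pM x xs.
have r0 : 0 < r by exact: le_lt_trans sr.
have M0 : 0 <= M.
  by rewrite (le_trans _ (pM x0 _))// subrr enorm0 ltW.
pose k : R := (2 * n + 16)%:R; pose eta : pol := r ^+ 2 *: 1 - psqn R n.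
have etaE y : pev eta y = r ^+ 2 - enorm (y - x0) ^+ 2.
  by rewrite pevB pevZ pev1 mulr1 pev_psqn.
have xr : enorm (x - x0) <= r by rewrite (le_trans xs)// ltW.
have k1 : 1 <= k by rewrite ler1n addnS.
have := pev_max_principle (M := k * r ^+ 2 * M ^+ 2)
  (fun y => @bernstein_subharmonic p i r y hp) _ xr.
rewrite -/k -/eta => H.
have d0 : 0 < r ^+ 2 - s ^+ 2 by rewrite subr_gt0 ltr_pXn2r// nnegrE ltW.
have Hx : pev (eta ^+ 2 * mderiv i p ^+ 2 + (k * r ^+ 2) *: p ^+ 2) x <= k * r ^+ 2 * M ^+ 2.
  apply: H => y yr.
  rewrite pevD pevM !pevX etaE yr subrr expr0n mul0r add0r pevZ pevX.
  rewrite ler_wpM2l ?mulr_ge0 ?(ltW r0)//.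
  by rewrite -real_normK ?num_real// ler_pXn2r ?nnegrE// pM// yr.
rewrite pevD pevM !pevX pevZ pevX etaE in Hx.
have e1 : (r ^+ 2 - s ^+ 2) <= r ^+ 2 - enorm (x - x0) ^+ 2.
  by rewrite lerD2l lerN2 ler_pXn2r ?nnegrE ?enorm_ge0.
rewrite mulrAC ler_pdivlMr// -(ler_pXn2r (n := 2)) ?nnegrE ?mulr_ge0 ?(ltW r0) ?(ltW d0)//.
  rewrite exprMn real_normK ?num_real// mulrC.
  apply: (@le_trans _ _ ((r ^+ 2 - enorm (x - x0) ^+ 2) ^+ 2 * pev (mderiv i p) x ^+ 2)).
    by rewrite ler_wpM2r ?sqr_ge0// ler_pXn2r ?nnegrE ?(ltW d0)// (le_trans (ltW d0)).
  apply: (le_trans (_ : _ <= k * r ^+ 2 * M ^+ 2)).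
    apply: le_trans Hx; rewrite lerDl mulr_ge0 ?sqr_ge0// mulr_ge0 ?sqr_ge0//.
  (* The square of the stated bound carries [k ^+ 2 >= k]; a square root of [k] is thus avoided. *)
  rewrite !exprMn -/k !ler_wpM2r ?sqr_ge0// expr2 ler_peMl//; exact: ler0n.
Qed.

(** [peuler q] at [z] is the derivative of [q] in the direction [z - x0]; a negative value would let
    [q] grow from [z] towards the centre, inside the ball. *)
Lemma peuler_ge0_at_max q r z : enorm (z - x0) <= r ->
  (forall x, enorm (x - x0) <= r -> pev q x <= pev q z) -> 0 <= pev (peuler q) z.
Proof.
move=> zr zmax.
have : is_derive z (z - x0) (pev q) (pev (peuler q) z).
  suff -> : pev (peuler q) z = \sum_i (z - x0) 0 i * pev (mderiv i q) z.
    exact: is_derive_pev.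
  by rewrite pev_sum; apply: eq_bigr => i _; rewrite pevM pev_var !mxE.
move=> [dq <-]; rewrite leNgt; apply/negP => lt0.
have : (fun t : R => t^-1 *: ((pev q \o shift z) (t *: (z - x0)) - pev q z)) @ (0 : R)^' -->
   'D_(z - x0) (pev q) z by exact: dq.
move=> /cvgr_lt /(_ 0 lt0) /nbhs_ballP[d /= d0 dP].
(* [t <= 1] keeps [z - t (z - x0)] in the ball, and [t < d] keeps [- t] where the difference
   quotient is negative. *)
pose t := Num.min (d / 2) 1.
have t0 : 0 < t by rewrite lt_min divr_gt0/=.
have t1 : t <= 1 by rewrite ge_min lexx orbT.
have td : t < d.
  by rewrite (@le_lt_trans _ _ (d / 2))// ?ge_min ?lexx// ltr_pdivrMr// ltr_pMr// ltr1n.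
have := dP (- t); rewrite /ball/= sub0r opprK gtr0_norm// oppr_eq0 gt_eqF// => /(_ td isT).
apply/negP; rewrite -leNgt -[_ *: _]/(_ * _) invrN mulNr oppr_ge0.
rewrite pmulr_rle0 ?invr_gt0// subr_le0; apply: zmax.
have -> : - t *: (z - x0) + z - x0 = (1 - t) *: (z - x0).
  by rewrite scalerBl scale1r scaleNr -addrA addrC.
rewrite enormZ ger0_norm ?subr_ge0// (le_trans _ zr)// ler_piMl ?enorm_ge0//.
by rewrite gerBl ltW.
Qed.

Lemma peuler_shift_bound (a : R) q h r e : 0 < a -> 0 <= r -> a *: q + peuler q = h ->
  (forall x, enorm (x - x0) <= r -> `|pev h x| <= e) ->
  forall x, enorm (x - x0) <= r -> `|pev q x| <= e / a.
Proof.
move=> a0 r0.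
have one q' h' : a *: q' + peuler q' = h' ->
    (forall x, enorm (x - x0) <= r -> `|pev h' x| <= e) ->
    forall x, enorm (x - x0) <= r -> pev q' x <= e / a.
  move=> E he x xr.
  have [||z zK zm] := @compact_EVT_max _ _ (pev q') _ _ (@compact_enorm_le r).
  - by exists x.
  - by apply: continuous_in_subspaceT => y _; exact: pev_continuous.
  rewrite inE/= in zK.
  have zm' y : enorm (y - x0) <= r -> pev q' y <= pev q' z by move=> yr; apply: zm; rewrite inE.
  rewrite (le_trans (zm' _ xr))// ler_pdivlMr// mulrC.
  rewrite (le_trans _ (he _ zK))// (le_trans _ (ler_norm _))// -E pevD pevZ lerDl.
  exact: peuler_ge0_at_max zm'.
move=> E he x xr; rewrite ler_norml (one _ _ E he _ xr) andbT lerNl -mulN1r -pevZ.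
apply: (one _ (-1 *: h)) xr => [|y yr].
  by rewrite peulerZ -E scalerDr !scalerA mulrC.
by rewrite pevZ mulN1r normrN he.
Qed.

End HarmonicPolynomials.

(** * Polynomial approximation on compact sets *)

Section PolynomialApproximation.
Variables (R : realType) (n : nat) (x0 : 'rV[R]_n) (K : set 'rV[R]_n).
Hypothesis compactK : compact K.
Local Notation pol := (mpoly n R).
Local Notation pev := (pev x0).
Implicit Types (x y z : 'rV[R]_n) (p q : pol) (f g : 'rV[R]_n -> R) (e : R).

Definition approximable f := forall e, 0 < e ->
  exists p, forall x, K x -> `|f x - pev p x| <= e.

Lemma bounded_on_compact f : (forall x, K x -> {for x, continuous f}) ->
  exists2 b : R, 0 < b & forall x, K x -> `|f x| <= b.
Proof.
move=> cf; have [->|/set0P K0] := eqVneq K set0; first by exists 1.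
have [|z zK zm] := @compact_EVT_max _ _ (fun x => `|f x|) _ K0 compactK.
  apply: (@continuous_in_subspaceT _ _ K) => y; rewrite inE => Ky.
  by apply: continuous_comp; [exact: cf|exact: norm_continuous].
exists (`|f z| + 1) => [|x Kx]; first by rewrite ltr_wpDl.
by rewrite (le_trans (zm x _)) ?inE// lerDl.
Qed.

(* The iteration [q' = q + (t^2 - q^2) / 2] increases to [`|t|]; its error [e]
   satisfies [e' <= e (1 - e / 2)]. *)
Lemma abs_iteration (a q : R) (k : nat) : 0 <= a <= 1 -> 0 <= a - q -> 0 <= q ->
  a - q <= 2 / k.+1%:R ->
  let q' := q + (a ^+ 2 - q ^+ 2) / 2 in
  [/\ 0 <= a - q', 0 <= q' & a - q' <= 2 / k.+2%:R].
Proof.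
move=> /andP[a0 a1] qa q0 qk q'.
have E : a - q' = (a - q) * (1 - (a + q) / 2) by rewrite /q'; field.
have qa' : q <= a by rewrite -subr_ge0.
split.
- by rewrite E mulr_ge0//; lra.
- by rewrite /q'; nra.
set e := a - q in E qa qk *; rewrite E.
apply: (@le_trans _ _ (e * (1 - e / 2))).
  by rewrite ler_wpM2l// /e; lra.
set k1 : R := k.+1%:R in qk *; have k10 : 1 <= k1 by rewrite ler1n.
have -> : k.+2%:R = k1 + 1 :> R by rewrite /k1 -[in LHS]addn1 natrD.
rewrite ler_pdivlMr; last by lra.
rewrite ler_pdivlMr in qk; last by lra.
(* This square bounds [e ^+ 2] from below by its tangent at [2 / (k1 + 1)]; what remains is linear
   in [e]. *)
have : 0 <= (e * (k1 + 1) - 2) ^+ 2 by exact: sqr_ge0.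
nra.
Qed.

Fixpoint pabs p k : pol :=
  if k is k'.+1 then pabs p k' + 2^-1 *: (p ^+ 2 - pabs p k' ^+ 2) else 0.

Lemma pabs_bound p x k : `|pev p x| <= 1 ->
  let a := `|pev p x| in let q := pev (pabs p k) x in
  [/\ 0 <= a - q, 0 <= q & a - q <= 2 / k.+1%:R].
Proof.
move=> p1 a; elim: k => [|k [h1 h2 h3]]; rewrite /=.
  rewrite pev0 subr0 /a; split=> //; first by rewrite (le_trans p1)// divr1 ler1n.
rewrite pevD pevZ pevB !pevX -(real_normK (num_real (pev p x))) -/a mulrC.
by apply: abs_iteration => //; rewrite /a normr_ge0.
Qed.

Lemma approximable_pev p : approximable (pev p).
Proof. by move=> e e0; exists p => x _; rewrite subrr normr0 ltW. Qed.

Lemma approximable_lin f g (c : R) : approximable f -> approximable g ->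
  approximable (fun x => f x + c * g x).
Proof.
move=> af ag e e0; have e2 : 0 < e / 2 by rewrite divr_gt0.
have c1 : 0 < `|c| + 1 by rewrite ltr_wpDl.
have [p hp] := af (e / 2) e2.
have [q hq] := ag (e / 2 / (`|c| + 1)) (divr_gt0 e2 c1).
exists (p + c *: q) => x Kx; rewrite pevD pevZ opprD addrACA -mulrBr.
rewrite (le_trans (ler_normD _ _))// [leRHS](splitr e) lerD ?hp// normrM.
rewrite (le_trans (ler_wpM2l (normr_ge0 _) (hq _ Kx)))// mulrCA ler_piMr//.
  by rewrite divr_ge0// ltW.
by rewrite ler_pdivrMr// mul1r lerDl.
Qed.

(** The iteration [pabs] works on values in [[-1, 1]], so [p] is first divided by a bound [b] on
    [K]; the error is multiplied back by [b]. *)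
Lemma approximable_norm f : approximable f -> approximable (fun x => `|f x|).
Proof.
move=> af e e0; have e2 : 0 < e / 2 by rewrite divr_gt0.
have [p hp] := af (e / 2) e2.
have [b b0 pb] := bounded_on_compact (fun x _ => @pev_continuous _ _ x0 p x).
have [k kP] : exists k : nat, b * (2 / k.+1%:R) <= e / 2.
  exists (Num.trunc (4 * b / e)).
  rewrite mulrA ler_pdivrMr ?ltr0n// -ler_pdivrMl ?divr_gt0//.
  have -> : (e / 2)^-1 * (b * 2) = 4 * b / e by field; rewrite gt_eqF.
  by rewrite ltW// truncnS_gt.
exists (b *: pabs (b^-1 *: p) k) => x Kx; rewrite pevZ.
have [|h1 h2 h3] := @pabs_bound (b^-1 *: p) x k.
  by rewrite pevZ normrM gtr0_norm ?invr_gt0// ler_pdivrMl// mulr1 pb.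
rewrite (le_trans (ler_distD `|pev p x| _ _))// [leRHS](splitr e) lerD//.
  by rewrite (le_trans (ler_dist_dist _ _))// hp.
have -> : `|pev p x| = b * `|pev (b^-1 *: p) x|.
  by rewrite pevZ normrM gtr0_norm ?invr_gt0// mulrA divff ?mul1r// gt_eqF.
by rewrite -mulrBr normrM gtr0_norm// ger0_norm// (le_trans _ kP)// ler_wpM2l// ltW.
Qed.

Lemma approximable_min f g : approximable f -> approximable g ->
  approximable (fun x => Num.min (f x) (g x)).
Proof.
move=> af ag.
suff -> : (fun x => Num.min (f x) (g x)) =
    (fun x => (0 + 2^-1 * (f x + 1 * g x)) + (- 2^-1) * `|f x + (-1) * g x|).
  apply: approximable_lin.
    apply: approximable_lin; last exact: approximable_lin.
    by have := approximable_pev 0; congr approximable; apply/funext => x; rewrite pev0.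
  exact/approximable_norm/approximable_lin.
apply/funext => x; rewrite add0r !mul1r mulN1r.
by case: (leP (f x) (g x)) => h; [rewrite ler0_norm ?subr_le0//; field|
  rewrite gtr0_norm ?subr_gt0//; field].
Qed.

Lemma stone_weierstrass f : (forall x, K x -> {for x, continuous f}) -> approximable f.
Proof.
move=> cf; have [b b0 fb] := bounded_on_compact cf.
suff H e : 0 < e -> exists g, [/\ approximable g, forall x, K x -> f x <= g x &
    forall x, K x -> g x <= f x + e].
  move=> e e0; have e2 : 0 < e / 2 by rewrite divr_gt0.
  have [g [ag gf fg]] := H _ e2; have [p hp] := ag _ e2.
  exists p => x Kx; rewrite (le_trans (ler_distD (g x) _ _))// [leRHS](splitr e) lerD ?hp//.
  by rewrite distrC ger0_norm ?subr_ge0 ?gf// lerBlDl fg.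
move=> e0.
(* [phi y] is a paraboloid with vertex at [y], steep enough to lie above [f] on [K];
   the minimum of finitely many of them approximates [f] from above. *)
have /choice[phi phiP] : forall y, exists ph : pol, K y ->
    (forall z, K z -> f z <= pev ph z) /\ \forall z \near y, pev ph z < f z + e.
  move=> y.
  have [Ky|] := pselect (K y); last by exists 0.
  have e3 : 0 < e / 3 by rewrite divr_gt0.
  have := cf _ Ky => /cvgrPdist_le /(_ _ e3) fy.
  have [d d0 dP] : exists2 d, 0 < d & forall z, enorm (z - y) < d -> `|f y - f z| <= e / 3.
    move: fy => /nbhs_ballP[d /= d0 dP]; exists d => // z zd; apply: dP.
    rewrite mx_norm_ball /ball_/= -normrN opprB.
    exact: le_lt_trans (norm_le_enorm _) zd.
  (* Outside the ball of radius [d] the quadratic term is at least [2 * b], which no difference of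
     two values of [f] on [K] exceeds. *)
  pose c := 2 * b / d ^+ 2.
  pose ph : pol := (f y + e / 3) *: 1 +
    c *: \sum_i (pvar R i - (y 0 i - x0 0 i) *: 1) ^+ 2.
  have phE z : pev ph z = f y + e / 3 + c * enorm (z - y) ^+ 2.
    rewrite pevD !pevZ pev1 mulr1 pev_sum enorm_sqr; congr (_ + _ * _).
    apply: eq_bigr => i _; rewrite pevX pevB pevZ pev1 mulr1 pev_var !mxE.
    by congr (_ ^+ 2); ring.
  have c0 : 0 <= c by rewrite divr_ge0 ?sqr_ge0// mulr_ge0// ltW.
  exists ph => _; split=> [z Kz|].
    rewrite phE; have [zd|zd] := ltP (enorm (z - y)) d.
      have := dP _ zd; rewrite ler_distlC => /andP[_ h].
      by rewrite (le_trans h)// lerDl mulr_ge0// sqr_ge0.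
    have : 2 * b <= c * enorm (z - y) ^+ 2.
      rewrite /c mulrAC ler_pdivlMr ?exprn_gt0// ler_pM2l ?mulr_gt0//.
      by rewrite ler_pXn2r ?nnegrE ?enorm_ge0// ltW.
    have := fb _ Kz; have := fb _ Ky; rewrite !ler_norml => /andP[h1 h2] /andP[h3 h4].
    by lra.
  have cz : {for y, continuous (pev ph - f)}.
    exact: continuousB (@pev_continuous _ _ x0 ph y) (cf _ Ky).
  have lt_e : (pev ph - f) y < e.
    rewrite -[ltLHS]/(pev ph y - f y) phE subrr enorm0 expr0n mulr0 addr0 addrAC subrr add0r.
    by rewrite ltr_pdivrMr// ltr_pMr// ltr1n.
  move: cz => /cvgr_lt /(_ e lt_e); apply: filterS => z.
  by rewrite -[ltLHS]/(pev ph z - f z) ltrBlDl.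
(* The interior is taken because [f] is only assumed continuous at points of [K], so the set itself
   need not be open. *)
pose U y := ([set z | pev (phi y) z < f z + e])^°%classic.
have cK := compactK; rewrite compact_cover in cK.
have [|z Kz|D DK Dcov] := cK _ K U.
- by move=> y _; exact: open_interior.
- by exists z => //; have [_] := phiP _ Kz.
(* The fold starts from [b], a bound of [f] on [K], so that [g] stays above [f] there. *)
pose g (s : seq 'rV[R]_n) z := foldr (fun y m => Num.min (pev (phi y) z) m) b s.
exists (g (finmap.enum_fset D)); split.
- elim: (finmap.enum_fset D) => [|y s IH].
    have := approximable_pev (b *: 1); congr approximable.
    by apply/funext => z; rewrite pevZ pev1 mulr1.
  exact: (approximable_min (approximable_pev (phi y)) IH).
- move=> x Kx; have : {subset finmap.enum_fset D <= K} by move=> y /DK; rewrite inE.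
  elim: (finmap.enum_fset D) => [_|y s IH sK] /=; first by rewrite (le_trans (ler_norm _))// fb.
  rewrite le_min IH ?andbT; last by move=> z zs; apply: sK; rewrite inE zs orbT.
  have /phiP[h _] : K y by have := sK y; rewrite !inE eqxx => /(_ isT).
  exact: h.
- move=> x Kx; have [y yD /interior_subset /= /ltW xy] := Dcov _ Kx.
  apply: le_trans xy; move: (yD : y \in finmap.enum_fset D).
  elim: (finmap.enum_fset D) => // z s IH; rewrite inE => /orP[/eqP ->|ys] /=.
    by rewrite ge_min lexx.
  by rewrite ge_min IH ?orbT.
Qed.

End PolynomialApproximation.

(** * Limits of sequences of polynomials *)

Section UniformLimits.
Variables (R : realType) (n : nat) (x0 : 'rV[R]_n).
Local Notation pol := (mpoly n R).
Local Notation pev := (pev x0).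
Implicit Types (x y z : 'rV[R]_n) (q : pol) (p : nat -> pol) (r s e : R) (i : 'I_n).

Definition uniform_cauchy r p := forall e, 0 < e -> exists N : nat,
  forall j k, (N <= j)%N -> (N <= k)%N ->
  forall x, enorm (x - x0) <= r -> `|pev (p j) x - pev (p k) x| <= e.

Definition pderivs (l : seq 'I_n) q := foldl (fun q i => mderiv i q) q l.

(** Cauchy for uniform convergence of all derivatives on the closed ball of radius [s]; [l] lists
    the directions of successive differentiation. *)
Definition smooth_cauchy s p := forall l, uniform_cauchy s (fun k => pderivs l (p k)).

Definition plim p x : R := lim (pev (p k) x @[k --> \oo]).

Lemma uniform_cauchyW r s p : s <= r -> uniform_cauchy r p -> uniform_cauchy s p.
Proof.
move=> sr up e /up[N NP]; exists N => j k Nj Nk x xs; apply: NP => //.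
exact: le_trans sr.
Qed.

Lemma uniform_cauchyD s p p' : uniform_cauchy s p -> uniform_cauchy s p' ->
  uniform_cauchy s (fun k => p k + p' k).
Proof.
move=> up up' e e0; have e2 : 0 < e / 2 by rewrite divr_gt0.
have [N NP] := up _ e2; have [N' NP'] := up' _ e2.
exists (maxn N N') => j k; rewrite !geq_max => /andP[j1 j2] /andP[k1 k2] x xs.
rewrite !pevD opprD addrACA (le_trans (ler_normD _ _))// [leRHS]splitr.
by rewrite lerD ?NP ?NP'.
Qed.

Lemma uniform_cauchy_cst s q : uniform_cauchy s (fun=> q).
Proof. by move=> e e0; exists 0%N => j k _ _ x _; rewrite subrr normr0 ltW. Qed.

Lemma uniform_cauchy_sum s (I : Type) (l : seq I) (F : I -> nat -> pol) :
  (forall a, uniform_cauchy s (F a)) -> uniform_cauchy s (fun k => \sum_(a <- l) F a k).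
Proof.
move=> uF; elim: l => [|a l IH].
  by under eq_fun do rewrite big_nil; exact: uniform_cauchy_cst.
by under eq_fun do rewrite big_cons; exact: uniform_cauchyD.
Qed.

Lemma uniform_cauchyM s q p : uniform_cauchy s p -> uniform_cauchy s (fun k => q * p k).
Proof.
move=> up e e0.
have [b b0 qb] := bounded_on_compact (@compact_enorm_le _ _ x0 s)
  (fun x _ => @pev_continuous _ _ x0 q x).
have [N NP] := up _ (divr_gt0 e0 b0); exists N => j k Nj Nk x xs.
rewrite !pevM -mulrBr normrM -[e](divfK (lt0r_neq0 b0)) mulrC.
by rewrite ler_pM// ?NP// qb.
Qed.

Lemma pderivsD l q q' : pderivs l (q + q') = pderivs l q + pderivs l q'.
Proof. by elim: l q q' => //= i l IH q q'; rewrite mderivD IH. Qed.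

Lemma pderivs_sum l (I : Type) (t : seq I) (F : I -> pol) :
  pderivs l (\sum_(a <- t) F a) = \sum_(a <- t) pderivs l (F a).
Proof.
apply: big_morph; first exact: pderivsD.
by elim: l => //= i l IH; rewrite mderiv0.
Qed.

Lemma smooth_cauchy_mderiv s p i : smooth_cauchy s p -> smooth_cauchy s (fun k => mderiv i (p k)).
Proof. by move=> sp l; exact: (sp (i :: l)). Qed.

Lemma smooth_cauchy_plap s p : smooth_cauchy s p -> smooth_cauchy s (fun k => plap (p k)).
Proof.
move=> sp l; under eq_fun do rewrite /plap pderivs_sum.
by apply: uniform_cauchy_sum => i; exact: (sp (i :: i :: l)).
Qed.

Lemma smooth_cauchyM s q p : smooth_cauchy s p -> smooth_cauchy s (fun k => q * p k).
Proof.
move=> sp l; elim: l q p sp => [|i l IH] q p sp; first exact: (uniform_cauchyM q (sp [::])).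
under eq_fun do rewrite /= mderivM -/(pderivs l _) pderivsD.
by apply: uniform_cauchyD; apply: IH => //; exact: smooth_cauchy_mderiv.
Qed.

(** Induction on the number of derivatives. Each costs a smaller radius: the differences [p j - p k]
    are harmonic, and [mderiv_bound] passes from radius [r] to the midpoint of [s] and [r]. *)
Lemma smooth_cauchy_harmonic r s p : (0 < n)%N -> 0 <= s -> s < r ->
  (forall k, plap (p k) = 0) -> uniform_cauchy r p -> smooth_cauchy s p.
Proof.
move=> n0 s0 sr hp up l; elim: l r sr p hp up => [|i l IH] r sr p hp up.
  by apply: uniform_cauchyW up; exact: ltW.
have [st tr] := midf_lt sr; set t := _ / _ in st tr.
apply: (IH t) => // [k|e e0]; first by rewrite -mderiv_plap hp mderiv0.
have r0 : 0 < r by exact: le_lt_trans sr.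
have t0 : 0 <= t by rewrite (le_trans s0)// ltW.
pose C : R := (2 * n + 16)%:R * r / (r ^+ 2 - t ^+ 2).
have C0 : 0 < C.
  rewrite divr_gt0// ?mulr_gt0// ?ltr0n ?addnS//.
  by rewrite subr_gt0 ltr_pXn2r// nnegrE// ltW.
have [N NP] := up _ (divr_gt0 e0 C0); exists N => j k Nj Nk x xt.
rewrite -pevB -mderivB -[e](divfK (lt0r_neq0 C0)) mulrC.
apply: (mderiv_bound n0 i t0 tr) xt; first by rewrite plapB !hp subrr.
by move=> y yr; rewrite pevB NP.
Qed.

Lemma plim_cvg s p x : uniform_cauchy s p -> enorm (x - x0) <= s ->
  pev (p k) x @[k --> \oo] --> plim p x.
Proof.
move=> up xs; apply/cauchy_cvgP/cauchy_exP => e /= e0.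
have [N NP] := up _ (divr_gt0 e0 (ltr0Sn R 1)).
exists (pev (p N) x); exists N => // k /= Nk.
rewrite /ball/= (le_lt_trans (NP _ _ _ Nk x xs))//.
by rewrite ltr_pdivrMr// ltr_pMr// ltr1n.
Qed.

Lemma plim_uniform s p e : uniform_cauchy s p -> 0 < e -> exists N : nat,
  forall k, (N <= k)%N -> forall x, enorm (x - x0) <= s -> `|plim p x - pev (p k) x| <= e.
Proof.
move=> up e0; have [N NP] := up _ e0; exists N => k Nk x xs.
apply/ler_addgt0Pl => d d0.
have /cvgrPdist_le /(_ _ d0) [M _ MP] := plim_cvg up xs.
rewrite (le_trans (ler_distD (pev (p (maxn N M)) x) _ _))// lerD//.
  by apply: MP; rewrite /= leq_maxr.
by rewrite NP// leq_maxl.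
Qed.

Lemma segment_bound q i x (h e : R) :
  (forall t : R, `|t| <= `|h| -> `|pev (mderiv i q) (x + t *: 'e_i)| <= e) ->
  `|pev q (x + h *: 'e_i) - pev q x| <= `|h| * e.
Proof.
move=> He; pose f (t : R) := pev q (x + t *: 'e_i).
pose df (t : R) := pev (mderiv i q) (x + t *: 'e_i).
have fD t : is_derive t (1 : R) f (df t).
  by apply/is_derive_line; rewrite /df -partial_pev; apply/derivableP/pev_derivable.
have -> : pev q x = f 0 by rewrite /f scale0r addr0.
have cf a b : {within `[a, b], continuous f}.
  by apply: derivable_within_continuous => t _; exact: ex_derive.
have [h0|h0] := leP 0 h.
  have [|c] := @MVT_segment R f df 0 h h0 (fun t _ => fD t); first exact: cf.
  rewrite in_itv/= => /andP[c0 ch] E.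
  rewrite -/(f h) E subr0 normrM mulrC ler_wpM2l// He//.
  by rewrite !ger0_norm.
have [|c] := @MVT_segment R f df h 0 (ltW h0) (fun t _ => fD t); first exact: cf.
rewrite in_itv/= => /andP[ch c0] E.
rewrite -/(f h) distrC E sub0r normrM normrN mulrC ler_wpM2l// He//.
by rewrite !ler0_norm ?lerN2// ltW.
Qed.

(** Termwise differentiation. The mean value bound for [p j - p k] is uniform in [j], so the
    difference quotients of the limit stay within [e / 3] of those of one fixed [p k], whose
    convergence is known. *)
Lemma is_derive_plim s p i x : uniform_cauchy s p ->
  uniform_cauchy s (fun k => mderiv i (p k)) -> enorm (x - x0) < s ->
  is_derive x 'e_i (plim p) (plim (fun k => mderiv i (p k)) x).
Proof.
move=> up udp xs; set D := plim _ x.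
suff H : (fun t : R => t^-1 *: ((plim p \o shift x) (t *: 'e_i) - plim p x)) @ (0 : R)^' --> D.
  apply: DeriveDef; first by apply/cvg_ex; exists D.
  exact: cvg_lim H.
apply/cvgrPdist_le => e e0; have e3 : 0 < e / 3 by rewrite divr_gt0.
have [N NP] := udp _ e3; have [N' NP'] := plim_uniform udp e3.
pose k := maxn N N'.
have Dk : `|D - pev (mderiv i (p k)) x| <= e / 3 by rewrite NP' ?leq_maxr// ltW.
have [dk dkE] : is_derive x 'e_i (pev (p k)) (pev (mderiv i (p k)) x).
  by rewrite -partial_pev; apply/derivableP/pev_derivable.
have /cvgrPdist_le /(_ _ e3) q1 : (fun t : R => t^-1 *: ((pev (p k) \o shift x)
    (t *: 'e_i) - pev (p k) x)) @ (0 : R)^' --> pev (mderiv i (p k)) x.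
  by rewrite -dkE; exact: dk.
have [d d0 dP] := open_line 'e_i (@open_enorm_lt _ _ x0 s) xs.
have nd : \forall t \near (0 : R)^', t != 0 /\ `|t| < d.
  apply/nbhs_ballP; exists d => // t; rewrite /ball/= sub0r normrN => td t0.
  by split.
apply: filterS2 q1 nd => t q1 [t0 td]; rewrite /= [t *: _ + x]addrC in q1 *.
set y := x + t *: 'e_i in q1 *.
have ys : enorm (y - x0) < s by exact: dP.
have B : `|(plim p y - plim p x) - (pev (p k) y - pev (p k) x)| <= `|t| * (e / 3).
  apply/ler_addgt0Pl => a a0; have a2 : 0 < a / 2 by rewrite divr_gt0.
  have [N'' NP''] := plim_uniform up a2; pose j := maxn N N''.
  have := NP'' j (leq_maxr _ _) y (ltW ys); have := NP'' j (leq_maxr _ _) x (ltW xs).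
  have : `|pev (p j - p k) y - pev (p j - p k) x| <= `|t| * (e / 3).
    apply: segment_bound => t' t't; rewrite mderivB pevB.
    apply: NP; rewrite ?leq_maxl//; apply/ltW/dP.
    exact: le_lt_trans td.
  rewrite !pevB; set T := `|t| * _.
  rewrite !ler_norml => /andP[? ?] /andP[? ?] /andP[? ?]; apply/andP; split; lra.
have tn : 0 < `|t| by rewrite normr_gt0.
have B' : `|t^-1 * (plim p y - plim p x) - t^-1 * (pev (p k) y - pev (p k) x)| <= e / 3.
  by rewrite -mulrBr normrM normfV ler_pdivrMl.
rewrite -[X in `|_ - X|]/(t^-1 * _) in q1 *.
rewrite -[_ *: (plim p y - _)]/(t^-1 * _).
by move: Dk q1 B'; rewrite !ler_norml => /andP[? ?] /andP[? ?] /andP[? ?]; apply/andP; split; lra.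
Qed.

Lemma partial_plim s p i x : smooth_cauchy s p -> enorm (x - x0) < s ->
  partial i (plim p) x = plim (fun k => mderiv i (p k)) x.
Proof.
move=> sp xs; have [_ E] := @is_derive_plim s p i x (sp [::]) (sp [:: i]) xs.
exact: E.
Qed.

Lemma plim_continuous s p x : uniform_cauchy s p -> enorm (x - x0) < s ->
  {for x, continuous (plim p)}.
Proof.
move=> up xs.
suff H e : 0 < e -> \forall y \near x, `|plim p x - plim p y| <= e by
  exact: ((@cvgrPdist_le _ R^o _ (nbhs x) _ (plim p) (plim p x)).2 H).
move=> e0; have e3 : 0 < e / 3 by rewrite divr_gt0.
have [N NP] := plim_uniform up e3.
have cq : {for x, continuous (pev (p N))} by exact: pev_continuous.
move: cq => /cvgrPdist_le /(_ _ e3) cN.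
have nb : nbhs x [set y | enorm (y - x0) < s].
  by apply: open_nbhs_nbhs; split=> //; exact: open_enorm_lt.
near=> y; have h1 : `|pev (p N) x - pev (p N) y| <= e / 3 by near: y; exact: cN.
have h2 : enorm (y - x0) < s by near: y; exact: nb.
have := NP _ (leqnn N) _ (ltW h2); have := NP _ (leqnn N) _ (ltW xs); move: h1.
by rewrite !ler_norml => /andP[? ?] /andP[? ?] /andP[? ?]; apply/andP; split; lra.
Unshelve. all: by end_near. Qed.

(** The sequence is general in the induction, since a partial derivative of the limit is the limit
    of the differentiated sequence. *)
Lemma class_C_plim s p k : smooth_cauchy s p -> class_C k (eball x0 s) (plim p).
Proof.
elim: k p => [|k IH] p sp; first by split=> // x xs; exact: plim_continuous (sp [::]) xs.
split=> [x xs|i]; first exact: plim_continuous (sp [::]) xs.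
split=> [x xs|]; first by have [] := @is_derive_plim s p i x (sp [::]) (sp [:: i]) xs.
apply: (class_C_eq (@open_enorm_lt _ _ x0 s)) (IH _ (smooth_cauchy_mderiv i sp)).
by move=> x; rewrite inE => xs; rewrite (partial_plim i sp xs).
Qed.

Lemma laplacian_plim s p : smooth_cauchy s p ->
  {in eball x0 s, laplacian (plim p) =1 plim (fun k => plap (p k))}.
Proof.
move=> sp x xs'; have xs : enorm (x - x0) < s by rewrite inE in xs'.
have oB := @open_enorm_lt _ _ x0 s.
have E i : partial i (partial i (plim p)) x = plim (fun k => mderiv i (mderiv i (p k))) x.
  rewrite (partial_eq i oB (_ : {in _, _ =1 plim (fun k => mderiv i (p k))}))//.
    exact: partial_plim (smooth_cauchy_mderiv i sp) xs.
  by move=> y; rewrite inE => ys; exact: partial_plim ys.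
rewrite /laplacian; under eq_bigr do rewrite E.
apply/esym/cvg_lim => //; under eq_fun do rewrite /plap pev_sum.
apply: cvg_big => [|i _]; first exact: add_continuous.
exact: (plim_cvg (sp [:: i; i]) (ltW xs)).
Qed.

Lemma iter_laplacian_plim s p j : smooth_cauchy s p ->
  {in eball x0 s, iter_laplacian j (plim p) =1 plim (fun k => iter j (@plap R n) (p k))}.
Proof.
move=> sp; have sj j' : smooth_cauchy s (fun k => iter j' (@plap R n) (p k)).
  by elim: j' => // j' IH; exact: smooth_cauchy_plap.
elim: j => // j IH x xs.
rewrite /iter_laplacian/= (laplacian_eq (@open_enorm_lt _ _ x0 s) IH xs).
exact: laplacian_plim.
Qed.

End UniformLimits.

(** * Harmonic functions on punctured balls *)

Section Removability.
Variables (R : realType) (n : nat) (x0 : 'rV[R]_n).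
Hypothesis n_gt0 : (0 < n)%N.
Local Notation pol := (mpoly n R).
Local Notation pev := (pev x0).
Implicit Types (x y z : 'rV[R]_n) (q : pol) (p h : nat -> pol) (r s e : R) (i : 'I_n).

Definition punctured_ball r : set 'rV[R]_n := [set x | 0 < enorm (x - x0) < r].

Lemma open_punctured_ball r : open (punctured_ball r).
Proof.
have -> : punctured_ball r = [set x | 0 < enorm (x - x0)] `&` [set x | enorm (x - x0) < r].
  by rewrite /punctured_ball; apply/seteqP; split=> x /= => [/andP[]|[-> ->]].
by apply: openI; [exact: open_enorm_gt|exact: open_enorm_lt].
Qed.

Lemma compact_annulus a r : compact [set x | a <= enorm (x - x0) <= r].
Proof.
apply: (@compact_enorm _ _ x0 _ r) => [|x /andP[]//].
have -> : [set x | a <= enorm (x - x0) <= r] =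
    [set x | a <= enorm (x - x0)] `&` [set x | enorm (x - x0) <= r].
  by apply/seteqP; split=> x /= => [/andP[]|[-> ->]].
by apply: closedI; [exact: closed_enorm_ge|exact: closed_enorm_le].
Qed.

(** Replaces solving the Dirichlet problem: a Stone-Weierstrass approximation is reduced modulo
    [|x|^2 - r^2] to a harmonic polynomial with the same values on the sphere. *)
Lemma harmonic_sphere_approx r (f : 'rV[R]_n -> R) e :
  (forall x, enorm (x - x0) = r -> {for x, continuous f}) -> 0 < e ->
  exists q, plap q = 0 /\ forall x, enorm (x - x0) = r -> `|f x - pev q x| <= e.
Proof.
move=> cf e0.
have [|q qe] := @stone_weierstrass R n x0 _ (@compact_annulus r r) f _ e e0.
  by move=> x /= /andP[h1 h2]; apply: cf; apply/eqP; rewrite eq_le h1 h2.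
have [h [k [h0 qE]]] := harmonic_mod_sphere (r ^+ 2) q n_gt0.
exists h; split=> // x xr; have := qe x; rewrite /= xr lexx => /(_ isT).
by rewrite qE pevD pevM pevB pevZ pev1 mulr1 pev_psqn xr subrr mul0r addr0.
Qed.

(** The maximum principle for [g - t Phi] on an annulus [a <= |x - x0| <= r]: the difference is at
    most [0] on the inner sphere by domination, and at most [e + t b] on the outer one. Then [t]
    tends to [0] with [x] fixed. *)
Lemma punctured_max_principle (g Phi : 'rV[R]_n -> R) (rho r e : R) : r < rho -> 0 <= e ->
  class_C 2 (punctured_ball rho) g -> class_C 2 (punctured_ball rho) Phi ->
  (forall x, punctured_ball rho x -> laplacian g x = 0) ->
  (forall x, punctured_ball rho x -> laplacian Phi x = 0) ->
  (forall x, enorm (x - x0) = r -> g x <= e) ->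
  (forall t, 0 < t -> exists2 d, 0 < d & forall x, punctured_ball d x -> g x <= t * Phi x) ->
  forall x, 0 < enorm (x - x0) <= r -> g x <= e.
Proof.
move=> rrho e0 cg cP lg lP ge gP x /andP[x_gt0 xr].
have r0 : 0 < r by exact: lt_le_trans xr.
have cont f y : class_C 2 (punctured_ball rho) f -> 0 < enorm (y - x0) <= r ->
    {for y, continuous f}.
  move=> cf /andP[y0 yr]; apply: (class_C_continuous cf).
  by rewrite /punctured_ball /= y0 (le_lt_trans yr).
have [b b0 Pb] : exists2 b : R, 0 < b & forall y, enorm (y - x0) = r -> `|Phi y| <= b.
  have [|b b0 Pb] := bounded_on_compact (f := Phi) (@compact_annulus r r).
    move=> y /= /andP[h1 h2]; apply: cont => //; rewrite h2 andbT.
    exact: lt_le_trans h1.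
  by exists b => // y yr; apply: Pb; rewrite /= yr lexx.
apply/ler_addgt0Pr => e' e'0.
have B0 : 0 < b + `|Phi x| + 1 by rewrite !ltr_wpDr// ltr_wpDr.
pose t := e' / (b + `|Phi x| + 1); have t0 : 0 < t by rewrite divr_gt0.
have [d d0 dP] := gP _ t0.
(* Below [d], so that [t Phi] dominates [g] on the inner sphere, and at most [|x - x0|], so that [x]
   lies in the annulus. *)
pose a := Num.min (d / 2) (enorm (x - x0)).
have a0 : 0 < a by rewrite lt_min x_gt0 divr_gt0.
have ad : a < d.
  rewrite (@le_lt_trans _ _ (d / 2))// ?ge_min ?lexx//.
  by rewrite ltr_pdivrMr// ltr_pMr// ltr1n.
have ax : a <= enorm (x - x0) by rewrite ge_min lexx orbT.
pose U : set 'rV[R]_n := [set y | a < enorm (y - x0)] `&` [set y | enorm (y - x0) < r].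
pose f y := g y + (- t) * Phi y.
have oU : open U by apply: openI; [exact: open_enorm_gt|exact: open_enorm_lt].
have Usub : U `<=` punctured_ball rho.
  by move=> y [/= h1 h2]; rewrite /punctured_ball/= (lt_trans a0)//= (lt_trans h2).
have fx : f x <= e + t * b.
  apply: (@maximum_principle R n [set y | a <= enorm (y - x0) <= r] U f) => //.
  - exact: compact_annulus.
  - by move=> y [/= /ltW y1 /ltW y2]; rewrite /= y1.
  - move=> y /= /andP[y1 y2].
    have yr : 0 < enorm (y - x0) <= r by rewrite y2 (lt_le_trans a0).
    apply: (continuousD (cont g y cg yr)); apply: continuousM; first exact: cst_continuous.
    exact: (cont Phi y cP yr).
  - by apply: class_C_lin => //; [exact: class_CS cg|exact: class_CS cP].
  - move=> y Uy; rewrite (laplacian_lin (- t) oU (class_CS Usub cg) (class_CS Usub cP)) ?inE//.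
    by rewrite lg ?lP ?mulr0 ?addr0//; exact: Usub.
  - move=> y /= /andP[y1 y2] nU; rewrite /f mulNr.
    have [ya|ya] := eqVneq (enorm (y - x0)) a.
      rewrite (@le_trans _ _ 0)//; last by rewrite addr_ge0// mulr_ge0// ltW.
      by rewrite subr_le0 dP// /punctured_ball /= ya a0.
    have yr : enorm (y - x0) = r.
      apply/eqP; rewrite eq_le y2 leNgt; apply/negP => yr; apply: nU; split=> //=.
      by rewrite lt_neqAle eq_sym ya.
    rewrite lerD ?ge// -mulrN ler_pM2l//.
    by have := Pb _ yr; rewrite ler_norml => /andP[h _]; rewrite lerNl.
  - by rewrite /= ax.
have : t * (b + Phi x) <= e'.
  rewrite /t mulrAC ler_pdivrMr// ler_pM2l// -addrA lerD2l.
  by rewrite (le_trans (ler_norm _))// lerDl.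
by move: fx; rewrite /f; lra.
Qed.

Lemma uniform_cauchy_of_approx r h (w : 'rV[R]_n -> R) : 0 < r ->
  (forall k, plap (h k) = 0) ->
  (forall k x, enorm (x - x0) = r -> `|w x - pev (h k) x| <= k.+1%:R^-1) ->
  uniform_cauchy x0 r h.
Proof.
move=> r0 hh wh e e0; have [N NP] : exists N : nat, N.+1%:R^-1 <= e / 2.
  exists (Num.trunc (2 / e)); rewrite -lef_pV2 ?posrE ?invr_gt0 ?divr_gt0 ?ltr0n//.
  by rewrite invrK invf_div ltW// truncnS_gt.
exists N => j k Nj Nk x xr; rewrite -pevB.
apply: (harmonic_bound n_gt0) xr => [|y yr]; first by rewrite plapB !hh subrr.
have small l : (N <= l)%N -> `|w y - pev (h l) y| <= e / 2.
  move=> Nl; rewrite (le_trans (wh _ _ yr))// (le_trans _ NP)//.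
  by rewrite lef_pV2 ?posrE ?ltr0n// ler_nat ltnS.
rewrite pevB (le_trans (ler_distD (w y) _ _))// [leRHS]splitr lerD ?small//.
by rewrite distrC small.
Qed.

(** The sequence [h] is returned rather than its limit alone, so that Almansi's construction can be
    carried out on polynomials. Its limit extends [w] across [x0]. *)
Lemma harmonic_removable (w Phi : 'rV[R]_n -> R) (rho r : R) : 0 < r -> r < rho ->
  class_C 2 (punctured_ball rho) w -> class_C 2 (punctured_ball rho) Phi ->
  (forall x, punctured_ball rho x -> laplacian w x = 0) ->
  (forall x, punctured_ball rho x -> laplacian Phi x = 0) ->
  (forall b, exists2 d, 0 < d & forall x, punctured_ball d x -> b <= Phi x) ->
  (forall t, 0 < t -> exists2 d, 0 < d &
     forall x, punctured_ball d x -> `|w x| <= t * `|Phi x|) ->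
  exists h, [/\ forall k, plap (h k) = 0, uniform_cauchy x0 r h &
    forall x, 0 < enorm (x - x0) <= r -> plim x0 h x = w x].
Proof.
move=> r0 rrho cw cP lw lP Poo wo.
have cwr x : enorm (x - x0) = r -> {for x, continuous w}.
  by move=> xr; apply: (class_C_continuous cw); rewrite /punctured_ball/= xr r0.
have /choice[h hP] : forall k : nat, exists q, plap q = 0 /\
    forall x, enorm (x - x0) = r -> `|w x - pev q x| <= k.+1%:R^-1.
  by move=> k; apply: harmonic_sphere_approx; rewrite // invr_gt0 ltr0n.
have hh k : plap (h k) = 0 by case: (hP k).
have uh : uniform_cauchy x0 r h.
  by apply: (uniform_cauchy_of_approx r0 hh) => k x xr; case: (hP k) => _; exact.
have oA := @open_punctured_ball rho.
(* A polynomial is bounded near [x0] and [Phi] tends to infinity there, so subtracting one from [w]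
   keeps it dominated by every [t Phi]. *)
have small q t : 0 < t -> exists2 d, 0 < d & forall x, punctured_ball d x ->
    `|w x| + `|pev q x| <= t * Phi x.
  move=> t0; have t2 : 0 < t / 2 by rewrite divr_gt0.
  have [d d0 dP] := wo _ t2.
  have [b b0 bP] := bounded_on_compact (@compact_enorm_le _ _ x0 r)
    (fun x _ => @pev_continuous _ _ x0 q x).
  have [d' d'0 d'P] := Poo (b / (t / 2)).
  exists (Num.min r (Num.min d d')); first by rewrite !lt_min r0 d0.
  move=> x /=; rewrite /punctured_ball/= !lt_min => /and4P[x1 x2 x3 x4].
  have Px : b / (t / 2) <= Phi x by apply: d'P; rewrite /punctured_ball/= x1.
  have Px0 : 0 <= Phi x by rewrite (le_trans _ Px)// divr_ge0// ltW.
  have := dP x; rewrite /punctured_ball/= x1 x3 (ger0_norm Px0) => /(_ isT) wx.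
  rewrite [t]splitr mulrDl lerD// (le_trans (bP x (ltW x2)))//.
  by rewrite mulrC -ler_pdivrMr.
(* The bound on the sphere spreads to the punctured ball by the maximum principle, applied to
   [w - h k] and to its negative. *)
have wh k x : 0 < enorm (x - x0) <= r -> `|w x - pev (h k) x| <= k.+1%:R^-1.
  move=> xr; have k0 : 0 <= k.+1%:R^-1 :> R by rewrite invr_ge0.
  have [hk0 hkP] := hP k.
  have ch : class_C 2 (punctured_ball rho) (pev (h k)) by exact: class_C_pev.
  have lh y : laplacian (pev (h k)) y = 0 by rewrite laplacian_pev hk0 pev0.
  rewrite ler_norml; apply/andP; split.
    rewrite lerNl opprB; have -> : pev (h k) x - w x = pev (h k) x + (-1) * w x by ring.
    apply: (punctured_max_principle (Phi := Phi) (g := fun y => pev (h k) y + (-1) * w y)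
      rrho k0 (class_C_lin (-1) oA ch cw) cP _ lP) xr => [y Ay|y yr|t t0].
    - by rewrite (laplacian_lin (-1) oA ch cw) ?inE// lh lw// mulr0 addr0.
    - by rewrite mulN1r (le_trans (ler_norm _))// distrC hkP.
    - have [d d0 dP] := small (h k) _ t0; exists d => // y yd.
      rewrite (le_trans _ (dP _ yd))// mulN1r addrC lerD// ?ler_norm//.
      by rewrite (le_trans (ler_norm _))// normrN.
  have -> : w x - pev (h k) x = w x + (-1) * pev (h k) x by ring.
  apply: (punctured_max_principle (Phi := Phi) (g := fun y => w y + (-1) * pev (h k) y)
    rrho k0 (class_C_lin (-1) oA cw ch) cP _ lP) xr => [y Ay|y yr|t t0].
  - by rewrite (laplacian_lin (-1) oA cw ch) ?inE// lh lw// mulr0 addr0.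
  - by rewrite mulN1r (le_trans (ler_norm _))// hkP.
  - have [d d0 dP] := small (h k) _ t0; exists d => // y yd.
    rewrite (le_trans _ (dP _ yd))// mulN1r lerD// ?ler_norm//.
    by rewrite (le_trans (ler_norm _))// normrN.
exists h; split=> // x /[dup] xr' /andP[x_gt0 xr].
apply/cvg_lim => //; apply/cvgrPdist_le => e e0.
exists (Num.trunc e^-1) => // k /= Nk; rewrite (le_trans (wh _ _ xr'))//.
rewrite -[leRHS]invrK lef_pV2 ?posrE ?invr_gt0 ?ltr0n//.
by rewrite ltW// (lt_le_trans (truncnS_gt _))// ler_nat ltnS.
Qed.

(** Induction on [j]. For harmonic [G], [plap_psqnM] reads [plap (psqn ^+ j.+1 * G) = c *: (psqn ^+
    j * (a *: G + peuler G))], so [G] is found by inverting [a + E] on [c^-1 *: G']. Harmonicity and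
    the Cauchy property survive the inversion by [plap_peuler_shift_inv] and
    [peuler_shift_bound]. *)
Lemma almansi r h j : 0 <= r -> (forall k, plap (h k) = 0) -> uniform_cauchy x0 r h ->
  exists G : nat -> pol, [/\ forall k, plap (G k) = 0, uniform_cauchy x0 r G &
    forall k, iter j (@plap R n) (psqn R n ^+ j * G k) = h k].
Proof.
move=> r0 hh uh; elim: j => [|j [G' [lG' uG' EG']]].
  by exists h; split=> // k; rewrite expr0 mul1r.
pose a : R := (n + 2 * j)%:R / 2; pose c : R := (4 * j.+1)%:R.
have a0 : 0 < a by rewrite divr_gt0// ltr0n addn_gt0 n_gt0.
have c0 : 0 < c by rewrite ltr0n muln_gt0.
have /choice[G GE] : forall k, exists q, a *: q + peuler q = c^-1 *: G' k.
  by move=> k; exact: peuler_shift_surj.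
have lG k : plap (G k) = 0.
  by apply: (plap_peuler_shift_inv a0 (GE k)); rewrite plapZ lG' scaler0.
exists G; split=> // [e e0|k].
  have [N NP] := uG' _ (mulr_gt0 (mulr_gt0 e0 a0) c0).
  exists N => i k Ni Nk x xr; rewrite -pevB.
  have -> : e = e * a / a by rewrite mulfK// gt_eqF.
  apply: (peuler_shift_bound (h := c^-1 *: (G' i - G' k)) a0 r0) xr => [|y yr].
    by rewrite scalerBr peulerB addrACA -opprD !GE scalerBr.
  rewrite pevZ normrM gtr0_norm ?invr_gt0// ler_pdivrMl// pevB mulrC.
  exact: NP.
rewrite iterSr plap_psqnM lG mulr0 addr0 -[RHS]EG'; congr (iter _ _ _).
rewrite scalerAr; congr (_ * _).
have -> : G' k = c *: (a *: G k + peuler (G k)) by rewrite GE scalerA divff ?scale1r// gt_eqF.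
rewrite !scalerDr !scalerA; congr (_ *: _ + _ *: _); last by rewrite /c -natrM; congr _%:R; lia.
by rewrite /c /a mulrC [RHS]mulrC mulrAC -mulrA; congr (_ * _); rewrite !natrM; field.
Qed.

End Removability.

(** * The fundamental solution *)

Section FundamentalSolution.
Variables (R : realType) (n : nat) (x0 : 'rV[R]_n).
Local Notation pol := (mpoly n R).
Local Notation pev := (pev x0).
Implicit Types (x y z : 'rV[R]_n) (q : pol) (i : 'I_n).

Definition off_center : set 'rV[R]_n := [set x | 0 < enorm (x - x0)].

Lemma open_off_center : open off_center.
Proof. exact: open_enorm_gt. Qed.

Definition inv_enorm x : R := (enorm (x - x0))^-1.

(** Linear combinations of these functions are closed under partial derivatives, which gives
    smoothness away from [x0] by induction. They contain the fundamental solution for [n >= 3] and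
    its gradient for [n = 2]. *)
Definition pev_inv_enorm q k x : R := pev q x * inv_enorm x ^+ k.

Lemma is_derive_pev_basis q x i : is_derive x 'e_i (pev q) (pev (mderiv i q) x).
Proof. by rewrite -partial_pev; apply/derivableP/pev_derivable. Qed.

Lemma is_derive_inv_enorm x i : off_center x ->
  is_derive x 'e_i inv_enorm (- (inv_enorm x ^+ 3 * pev (pvar R i) x)).
Proof.
rewrite /off_center/= => x1.
have -> : inv_enorm = (fun t => (Num.sqrt t)^-1) \o pev (psqn R n).
  by apply/funext => y /=; rewrite -enorm_sqrt_pev.
have N0 : 0 < pev (psqn R n) x by rewrite pev_psqn exprn_gt0.
have d1 := is_derive1_sqrt N0.
have s0 : Num.sqrt (pev (psqn R n) x) != 0 by rewrite gt_eqF// sqrtr_gt0.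
have [d2 d3] := is_derive_chain (is_derive_pev_basis (psqn R n) x i) (is_deriveV s0 d1).
apply: DeriveDef; first exact: d2.
rewrite [LHS]d3 mderiv_psqn pevZ /inv_enorm /= -!enorm_sqrt_pev -[_ *: _]/(_ * _).
by field; rewrite gt_eqF.
Qed.

Lemma is_derive_pev_inv_enorm q k x i : off_center x ->
  is_derive x 'e_i (pev_inv_enorm q k)
    (pev_inv_enorm (mderiv i q) k x + (- k%:R) * pev_inv_enorm (q * pvar R i) k.+2 x).
Proof.
move=> Ax.
have [d1 d2] := is_deriveM (is_derive_pev_basis q x i) (is_deriveX k (is_derive_inv_enorm i Ax)).
have eE y : (inv_enorm ^+ k) y = inv_enorm y ^+ k.
  by elim: k {d1 d2} => // k IH; rewrite !exprS -IH.
have fE : pev_inv_enorm q k = pev q * inv_enorm ^+ k.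
  by apply/funext => y; rewrite /pev_inv_enorm -eE.
rewrite {1}fE; apply: DeriveDef; first exact: d1.
rewrite [LHS]d2 /pev_inv_enorm pevM eE /GRing.scale/=.
case: k {d1 d2 eE fE} => [|k]; first by rewrite !mul0r !expr0 oppr0; ring.
by rewrite !exprS /=; ring.
Qed.

Lemma continuous_inv_enorm x : off_center x -> {for x, continuous inv_enorm}.
Proof.
move=> Ax; apply: continuousV; first by rewrite gt_eqF.
exact: enorm_continuous.
Qed.

Lemma partial_pev_inv_enorm q k i : {in off_center, partial i (pev_inv_enorm q k) =1
  fun x => pev_inv_enorm (mderiv i q) k x + (- k%:R) * pev_inv_enorm (q * pvar R i) k.+2 x}.
Proof. by move=> x; rewrite inE => /(is_derive_pev_inv_enorm q k i)[_ E]; exact: E. Qed.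

Lemma class_C_pev_inv_enorm d q k : class_C d off_center (pev_inv_enorm q k).
Proof.
have cF q' k' x : off_center x -> {for x, continuous (pev_inv_enorm q' k')}.
  move=> Ax; apply: continuousM; first exact: pev_continuous.
  apply: (@continuous_comp _ _ _ inv_enorm (fun t : R => t ^+ k')).
    exact: continuous_inv_enorm.
  exact: exprn_continuous.
elim: d q k => [|d IH] q k; first by split=> // x; exact: cF.
split=> [x|i]; first exact: cF.
split=> [x /(is_derive_pev_inv_enorm q k i)[]//|].
apply: class_C_eq open_off_center _
  (class_C_lin (- k%:R) open_off_center (IH (mderiv i q) k) (IH (q * pvar R i) k.+2)).
by move=> x Ax; rewrite (partial_pev_inv_enorm q k i Ax).
Qed.

(** Both fundamental solutions have gradient [c (x - x0) / |x - x0|^n]. Its divergence is zero: the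
    term [n |x - x0|^(-n)] from the coordinates cancels the one from the radial factor. *)
Lemma laplacian_radial (Phi : 'rV[R]_n -> R) (c : R) :
  (forall i, {in off_center, partial i Phi =1 fun x => c * pev_inv_enorm (pvar R i) n x}) ->
  {in off_center, laplacian Phi =1 fun=> 0}.
Proof.
move=> dP x Ax; have x1 : 0 < enorm (x - x0) by rewrite inE in Ax.
have E i : partial i (partial i Phi) x =
    c * (inv_enorm x ^+ n - n%:R * (inv_enorm x ^+ n.+2 * pev (pvar R i ^+ 2) x)).
  rewrite (partial_eq i open_off_center (dP i) Ax).
  have [d1 d2] := is_deriveZ c (is_derive_pev_inv_enorm (pvar R i) n i x1).
  rewrite [LHS]d2 -[LHS]/(_ * _); congr (_ * _).
  by rewrite /pev_inv_enorm mderiv_pvar eqxx pev1 -expr2; ring.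
rewrite /laplacian; under eq_bigr do rewrite E.
rewrite -mulr_sumr sumrB -mulr_sumr -mulr_sumr -pev_sum -/(psqn R n) sumr_const card_ord.
rewrite pev_psqn -[_ *+ n]mulr_natl -addn2 exprD -mulrA -exprMn /inv_enorm mulVf ?gt_eqF//.
by rewrite expr1n mulr1 subrr mulr0.
Qed.

Lemma punctured_ball_off_center r : punctured_ball x0 r `<=` off_center.
Proof. by move=> x /andP[]. Qed.

Lemma inv_enorm_ge (b : R) : 0 < b -> forall x, punctured_ball x0 b^-1 x -> b <= inv_enorm x.
Proof.
move=> b0 x /andP[x1 x2]; rewrite /inv_enorm -[leLHS]invrK lef_pV2 ?posrE ?invr_gt0//.
exact: ltW.
Qed.

Lemma power_fundamental (Phi := fun x => enorm (x - x0) ^ (2 - n%:Z)) : (3 <= n)%N ->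
  [/\ class_C 2 off_center Phi, {in off_center, laplacian Phi =1 fun=> 0} &
    forall b, exists2 d, 0 < d & forall x, punctured_ball x0 d x -> b <= Phi x].
Proof.
move=> n3; have PhiE : Phi = pev_inv_enorm 1 (n - 2).
  apply/funext => x; rewrite /Phi /pev_inv_enorm pev1 mul1r /inv_enorm.
  by rewrite (_ : 2 - n%:Z = - (n - 2)%:Z) ?invr_expz -?exprnN ?exprVn//; lia.
rewrite PhiE; split; first exact: class_C_pev_inv_enorm.
  apply: (@laplacian_radial _ (- (n - 2)%:R)) => i x Ax.
  rewrite (partial_pev_inv_enorm _ _ _ Ax) mul1r -mpolyC1 mderivC.
  rewrite {1}/pev_inv_enorm pev0 mul0r add0r; congr (_ * pev_inv_enorm _ _ _).
  by lia.
(* With [c >= 1] the inverse distance is at least [1] on the chosen ball, so its power [n - 2 >= 1]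
   is at least the inverse distance, hence at least [b]. *)
move=> b; pose c := Num.max b 1; have c0 : 0 < c by rewrite lt_max ltr01 orbT.
exists c^-1; first by rewrite invr_gt0.
move=> x /(inv_enorm_ge c0); rewrite ge_max => /andP[bx x1].
rewrite /pev_inv_enorm pev1 mul1r (le_trans bx)//.
by rewrite -[leLHS]expr1 ler_weXn2l//; lia.
Qed.

(** The logarithm is not of the form [pev_inv_enorm], but its first partial derivatives are up to
    sign; only the first differentiation is done by hand. *)
Lemma log_fundamental (Phi := fun x => ln (1 / enorm (x - x0))) : n = 2%N ->
  [/\ class_C 2 off_center Phi, {in off_center, laplacian Phi =1 fun=> 0} &
    forall b, exists2 d, 0 < d & forall x, punctured_ball x0 d x -> b <= Phi x].
Proof.
move=> n2; have PhiE : Phi = @ln R \o inv_enorm.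
  by apply/funext => x; rewrite /Phi div1r.
have i0 x : off_center x -> 0 < inv_enorm x by move=> Ax; rewrite invr_gt0.
have dPhi x i : off_center x ->
    is_derive x 'e_i Phi ((-1) * pev_inv_enorm (pvar R i) n x).
  move=> Ax; have [d1 d2] := is_derive_chain (is_derive_inv_enorm i Ax) (is_derive1_ln (i0 _ Ax)).
  rewrite PhiE; apply: DeriveDef; first exact: d1.
  have e2 : inv_enorm x ^+ n = inv_enorm x ^+ 2 by congr (_ ^+ _).
  by rewrite [LHS]d2 /pev_inv_enorm e2; field; rewrite gt_eqF// i0.
have pPhi i : {in off_center, partial i Phi =1 fun x => (-1) * pev_inv_enorm (pvar R i) n x}.
  by move=> x; rewrite inE => /(dPhi x i)[_ E]; exact: E.
split; last 2 first.
- exact: laplacian_radial pPhi.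
- move=> b; exists (expR b)^-1; first by rewrite invr_gt0 expR_gt0.
  move=> x xb; have := inv_enorm_ge (expR_gt0 b) xb.
  rewrite PhiE /= -[b in X in _ -> X]expRK ler_ln ?posrE ?expR_gt0//.
  by apply: i0; case/andP: xb.
split=> [x Ax|i].
  rewrite PhiE; apply: continuous_comp; first exact: continuous_inv_enorm.
  exact/continuous_ln/i0.
split=> [x /(dPhi x i)[]//|].
have cl : class_C 1 off_center (fun x => pev 0 x + (-1) * pev_inv_enorm (pvar R i) n x).
  apply: class_C_lin; [exact: open_off_center|exact: class_C_pev|].
  exact: class_C_pev_inv_enorm.
apply: (class_C_eq open_off_center _ cl) => x Ax.
by rewrite pPhi// pev0 add0r.
Qed.

End FundamentalSolution.

(** * Polyharmonic functions *)

Section PolyharmonicRemovability.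
Variables (R : realType) (n : nat) (x0 : 'rV[R]_n) (Phi : 'rV[R]_n -> R).
Hypotheses (n_gt0 : (0 < n)%N) (PhiC : class_C 2 (off_center x0) Phi)
  (Phi_harmonic : {in off_center x0, laplacian Phi =1 fun=> 0})
  (Phi_oo : forall b, exists2 d, 0 < d & forall x, punctured_ball x0 d x -> b <= Phi x).
Local Notation pball := (punctured_ball x0).
Implicit Types (u v f g : 'rV[R]_n -> R) (r s t : R).

(* [f = o(Phi)] at [x0], in terms of the Euclidean norm. *)
Definition negligible f := forall t, 0 < t -> exists2 d, 0 < d &
  forall x, pball d x -> `|f x| <= t * `|Phi x|.

Lemma punctured_ball_le s r : s <= r -> pball s `<=` pball r.
Proof. by move=> sr x /andP[x1 x2]; rewrite /punctured_ball/= x1 (lt_le_trans x2). Qed.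

Lemma punctured_ball_eball s : pball s `<=` eball x0 s.
Proof. by move=> x /andP[]. Qed.

(** Continuity at [x0] bounds [f] nearby, whereas [Phi] tends to infinity. *)
Lemma negligible_continuous f : {for x0, continuous f} -> negligible f.
Proof.
move=> cf t t0; have [d' d'0 d'P] := Phi_oo ((`|f x0| + 1) / t).
have : \forall x \near x0, `|f x| <= `|f x0| + 1.
  move: cf => /cvgrPdist_le /(_ _ ltr01); apply: filterS => x h.
  by rewrite -lerBlDl (le_trans (lerB_dist _ _))// distrC.
move=> /(@nbhs_dnbhs _ x0) /dnbhs_enormP[d d0 dP].
exists (Num.min d d'); first by rewrite lt_min d0.
move=> x; rewrite /punctured_ball/= lt_min => /and3P[x1 x2 x3].
rewrite (le_trans (dP x _)) ?x1// mulrC -ler_pdivrMr//.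
by rewrite (le_trans (d'P x _)) ?ler_norm// /punctured_ball/= x1.
Qed.

Lemma negligible_lin f g s (c : R) : 0 < s -> negligible f -> negligible g ->
  forall h, {in pball s, h =1 fun x => f x + c * g x} -> negligible h.
Proof.
move=> s0 nf ng h hE t t0; have c1 : 0 < `|c| + 1 by rewrite ltr_wpDl.
have t2 : 0 < t / 2 by rewrite divr_gt0.
have [d d0 dP] := nf _ t2; have [d' d'0 d'P] := ng _ (divr_gt0 t2 c1).
exists (Num.min s (Num.min d d')); first by rewrite !lt_min s0 d0.
move=> x; rewrite /punctured_ball/= !lt_min => /and4P[x1 x2 x3 x4].
rewrite hE ?inE /punctured_ball/= ?x1// (le_trans (ler_normD _ _))//.
rewrite [t]splitr mulrDl lerD//; first by apply: dP; rewrite /punctured_ball/= x1.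
rewrite normrM (le_trans (ler_wpM2l (normr_ge0 c) (d'P x _))) ?/punctured_ball/= ?x1//.
rewrite mulrA ler_wpM2r// mulrCA ler_piMr ?ltW// ltr_pdivrMr// mul1r.
by rewrite ltrDl.
Qed.

Lemma iter_laplacian0 k A (u : 'rV[R]_n -> R) : open A -> {in A, u =1 fun=> 0} ->
  {in A, iter_laplacian k u =1 fun=> 0}.
Proof.
move=> oA u0 x Ax; rewrite (iter_laplacian_eq k oA (_ : {in A, u =1 pev x0 0}) Ax).
  rewrite iter_laplacian_pev; have -> : iter k (@plap R n) 0 = 0.
    by elim: k => //= k ->; rewrite plap0.
  by rewrite pev0.
by move=> y Ay; rewrite u0// pev0.
Qed.

(** Induction on [m], for all [u] and [rho]. The limit [V] of the polynomials [|x|^(2m) G_k] is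
    smooth across [x0] and has the same [m]-th Laplacian as [u] near it, so the induction hypothesis
    applies to [u - V]. *)
Lemma polyharmonic_removable m u rho : 0 < rho -> class_C (2 * m) (pball rho) u ->
  {in pball rho, iter_laplacian m u =1 fun=> 0} ->
  (forall k, (k < m)%N -> negligible (iter_laplacian k u)) ->
  exists s v, [/\ 0 < s <= rho, smooth (eball x0 s) v,
    {in eball x0 s, iter_laplacian m v =1 fun=> 0} & {in pball s, u =1 v}].
Proof.
elim: m u rho => [|m IH] u rho rho0 cu lu nu.
  exists rho, (pev x0 0); split; first by rewrite rho0 lexx.
  - by move=> k; exact: class_C_pev.
  - by move=> x _; rewrite /iter_laplacian/= pev0.
  - by move=> x Ax; rewrite pev0 -(lu x Ax).
pose w := iter_laplacian m u.
have oA := @open_punctured_ball _ _ x0 rho.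
have cw : class_C 2 (pball rho) w.
  by apply: class_C_iter_laplacian => //; rewrite mulnS addnC in cu.
(* The approximation lives on the closed ball of radius [r < rho], the convergence of all
   derivatives on that of radius [s < r]. *)
pose r := rho / 2; pose s := r / 2.
have r0 : 0 < r by rewrite divr_gt0.
have rrho : r < rho by rewrite ltr_pdivrMr// ltr_pMr// ltr1n.
have s0 : 0 < s by rewrite divr_gt0.
have sr : s < r by rewrite ltr_pdivrMr// ltr_pMr// ltr1n.
have [h [hh uh hw]] : exists h : nat -> mpoly n R, [/\ forall k, plap (h k) = 0,
    uniform_cauchy x0 r h & forall x, 0 < enorm (x - x0) <= r -> plim x0 h x = w x].
  have cP : class_C 2 (pball rho) Phi.
    by apply: class_CS PhiC; exact: punctured_ball_off_center.
  have lw x : pball rho x -> laplacian w x = 0 by move=> Ax; apply: lu; rewrite inE.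
  have lP x : pball rho x -> laplacian Phi x = 0.
    by move=> /punctured_ball_off_center Ax; apply: Phi_harmonic; rewrite inE.
  exact: (harmonic_removable n_gt0 r0 rrho cw cP lw lP Phi_oo (nu m (ltnSn m))).
have [G [hG uG EG]] := almansi n_gt0 m (ltW r0) hh uh.
pose P k := psqn R n ^+ m * G k; pose V := plim x0 P.
have sP : smooth_cauchy x0 s P.
  apply: smooth_cauchyM; exact: (smooth_cauchy_harmonic n_gt0 (ltW s0) sr hG uG).
have oB s' := @open_enorm_lt R n x0 s'.
have cV k : class_C k (eball x0 s) V by exact: class_C_plim.
have lV : {in eball x0 s, iter_laplacian m V =1 plim x0 h}.
  move=> x xs; rewrite (iter_laplacian_plim m sP xs); congr (plim _ _ _).
  by apply/funext => k; exact: EG.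
have lV0 : {in eball x0 s, iter_laplacian m.+1 V =1 fun=> 0}.
  move=> x xs; rewrite (iter_laplacian_plim m.+1 sP xs).
  apply/cvg_lim => //; under eq_fun do rewrite /= EG hh pev0.
  exact: cvg_cst.
have As_rho : pball s `<=` pball rho by apply/punctured_ball_le/ltW/(lt_trans sr).
have As_B : pball s `<=` eball x0 s by exact: punctured_ball_eball.
have oAs := @open_punctured_ball _ _ x0 s.
have lin k : (k <= m)%N -> {in pball s, iter_laplacian k (fun x => u x + (-1) * V x) =1
    fun x => iter_laplacian k u x + (-1) * iter_laplacian k V x}.
  move=> km; apply: iter_laplacian_lin => //; last exact: class_CS As_B (cV _).
  by apply: class_CS As_rho (class_C_le _ cu); rewrite leq_mul2l/= (leq_trans km).
have [|x xs|k km|s' [v [/andP[s'0 s's] sv lv uv]]] := IH (fun x => u x + (-1) * V x) s s0.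
- apply: class_C_lin => //; last exact: class_CS As_B (cV _).
  by apply: class_CS As_rho (class_C_le _ cu); rewrite leq_mul2l/=.
- have xs' := set_mem xs; rewrite (lin m (leqnn m))// lV ?inE; last exact: As_B.
  case/andP: xs' => x1 x2; rewrite hw ?x1 ?(ltW (lt_trans x2 sr))//.
  by rewrite mulN1r subrr.
(* [V] is smooth at [x0], so its iterated Laplacians are negligible against [Phi]. *)
- apply: (negligible_lin s0 (nu k _) _ (lin k (ltnW km))); first exact: ltnW.
  apply: negligible_continuous; apply: (@class_C_continuous _ _ 0 (eball x0 s)).
    apply: class_C_iter_laplacian => //; first exact: oB.
  by rewrite /eball/= subrr enorm0.
have Bs's : eball x0 s' `<=` eball x0 s.
  by move=> x; rewrite /eball/= => xs; exact: lt_le_trans s's.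
exists s', (fun x => v x + 1 * V x); split.
- by rewrite s'0 (le_trans s's)// ltW// (lt_trans sr).
- by move=> k; apply: class_C_lin; [exact: oB|exact: sv|exact: class_CS Bs's (cV _)].
- move=> x xs; rewrite (iter_laplacian_lin 1 (oB s') (sv _) (class_CS Bs's (cV _)))//.
  rewrite lV0 ?mulr0 ?addr0; last by rewrite inE; apply: Bs's; exact: set_mem.
  (* One more Laplacian is applied to [Delta^m v = 0], hence the index [1]. *)
  exact: (@iter_laplacian0 1 _ _ (oB s') lv x xs).
- move=> x xs; have := uv x xs => <-; ring.
Qed.

End PolyharmonicRemovability.

(** * From little-o conditions to the theorem *)

Lemma littleo_norm_enormP (R : realType) (n : nat) (x0 : 'rV[R]_n) (f Phi : 'rV[R]_n -> R) :
  (fun x => `|f x|) =o_ (x0^') Phi <-> negligible x0 Phi f.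
Proof.
split=> [/eqoP fo t t0|nf].
  have /dnbhs_enormP[d d0 dP] := fo t t0; exists d => // x xd.
  by have := dP x xd; rewrite normr_id.
apply/eqoP => t t0; apply/dnbhs_enormP; have [d d0 dP] := nf t t0.
by exists d => // x xd; rewrite normr_id; exact: dP.
Qed.

(** Treats both dimension ranges at once, for a [Phi] harmonic off [x0] and tending to [+oo] there.
    Necessity: the Laplacians of the smooth extension are continuous at [x0]. Sufficiency:
    [polyharmonic_removable] on a ball inside [Omega]. *)
Lemma removable_singularityP (R : realType) (m n : nat) (Omega : set 'rV[R]_n)
    (x0 : 'rV[R]_n) (u Phi : 'rV[R]_n -> R) :
  (0 < n)%N -> open Omega -> Omega x0 -> polyharmonic m (Omega `\ x0) u ->
  [/\ class_C 2 (off_center x0) Phi, {in off_center x0, laplacian Phi =1 fun=> 0} &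
    forall b, exists2 d, 0 < d & forall x, punctured_ball x0 d x -> b <= Phi x] ->
  removable_singularity m Omega x0 u <->
  forall k, (k < m)%N -> (fun x => `|iter_laplacian k u x|) =o_ (x0^') Phi.
Proof.
move=> n0 oO Ox0 [cu lu] [cP lP Poo]; split.
  move=> [d [d0 _ [v [sv [cv lv] uv]]]] k km; apply/littleo_norm_enormP.
  have nv : negligible x0 Phi (iter_laplacian k v).
    apply: negligible_continuous => //; apply: (@class_C_continuous _ _ 0 (eball x0 d)).
      by apply: class_C_iter_laplacian; [exact: open_enorm_lt|exact: sv].
    by rewrite /eball/= subrr enorm0.
  (* The combination with coefficient [0] transfers negligibility from [v] to [u], which are known
     to agree on the punctured ball only. *)
  apply: (negligible_lin (c := 0) d0 nv nv) => x Ax; rewrite mul0r addr0.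
  apply: (iter_laplacian_eq k (@open_punctured_ball _ _ x0 d)) Ax => y; rewrite inE; exact: uv.
move=> no.
have [r r0 rO] : exists2 r, 0 < r & forall x, enorm (x - x0) < r -> Omega x.
  have /nbhs_ballP[r /= r0 rO] : nbhs x0 Omega by exact: open_nbhs_nbhs.
  exists r => // x xr; apply: rO; rewrite mx_norm_ball /ball_/= -normrN opprB.
  exact: le_lt_trans (norm_le_enorm _) xr.
have sub : punctured_ball x0 r `<=` Omega `\ x0.
  move=> x /andP[x1 x2]; split; first exact: rO.
  by move=> /= xx; move: x1; rewrite xx subrr enorm0 ltxx.
have [||k km|s [v [/andP[s0 sr] sv lv uv]]] :=
  @polyharmonic_removable _ _ x0 Phi n0 cP lP Poo m u r r0.
- exact: class_CS sub cu.
- by move=> x; rewrite inE => /sub; exact: lu.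
- exact/littleo_norm_enormP/no.
have s2 : s / 2 < s by rewrite ltr_pdivrMr// ltr_pMr// ltr1n.
have Bs : eball x0 (s / 2) `<=` eball x0 s by move=> x /lt_trans; apply.
(* The radius is halved so that the closed ball remains in [Omega]. *)
exists (s / 2); split; first by rewrite divr_gt0.
  apply: subset_trans (_ : [set x | enorm (x - x0) <= s / 2] `<=` _).
    rewrite closureE; apply: smallest_sub; first exact: closed_enorm_le.
    by move=> x /ltW.
  by move=> x /= xs; apply: rO; rewrite (le_lt_trans xs)// (lt_le_trans s2).
exists v; split.
- by move=> k; exact: class_CS Bs (sv k).
- split; first exact: class_CS Bs (sv _).
  by move=> x /Bs xs; apply: lv; rewrite inE.
- move=> x /andP[x1 x2]; apply: uv; rewrite inE /punctured_ball/= x1.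
  exact: lt_trans s2.
Qed.

Theorem theorem1 (R : realType) (m n : nat) (Omega : set 'rV[R]_n)
    (x0 : 'rV[R]_n) (u : 'rV[R]_n -> R) :
  (2 <= m)%N -> (2 <= n)%N ->
  domain Omega -> Omega x0 ->
  polyharmonic m (Omega `\ x0) u ->
  removable_singularity m Omega x0 u <->
  ((3 <= n)%N -> forall k : nat, (k < m)%N ->
     (fun x => `|iter_laplacian k u x|) =o_ (x0^')
     (fun x => enorm (x - x0) ^ (2 - n%:Z))) /\
  (n = 2%N -> forall k : nat, (k < m)%N ->
     (fun x => `|iter_laplacian k u x|) =o_ (x0^')
     (fun x => ln (1 / enorm (x - x0)))).
Proof.
move=> _ n2 [_ oO _] Ox0 pu; have n0 : (0 < n)%N by exact: ltnW.
have [n3|n3] := ltnP 2 n.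
  have E := removable_singularityP n0 oO Ox0 pu (@power_fundamental R n x0 n3).
  split=> [/E h|[h _]]; last exact/E/h.
  by split=> // e; exfalso; move: n3; rewrite e.
have e : n = 2%N by apply/eqP; rewrite eqn_leq n3.
have E := removable_singularityP n0 oO Ox0 pu (@log_fundamental R n x0 e).
split=> [/E h|[_ h]]; last exact/E/h.
by split=> // n3'; exfalso; move: n3; rewrite leqNgt n3'.
Qed.
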